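(* Consider two independent samples of nonnegative zero-inflated data, sample 1 of size $n_1$ and sample 0 of size $n_0$. Let $p_k=P(y_k>0)$ be the probability of a positive value in group $k\in\{0,1\}$, let $y_k^+$ denote a variable with the conditional distribution of $y_k$ given $y_k>0$, and put $m=p_1-p_0$ and $d=P(y_1^+>y_0^+)-\tfrac12$. Consider the compound testing problem $H_0: m=0 \text{ and } d=0$ versus $H_1: (1-I_{m>0})(1-I_{d>0})=0$ (that is, $m>0$ or $d>0$). Let $p\in(0,1]$ be the proportion of positive values under $H_0$, let $\phi\in[0,\pi/2]$ be the direction of the compound alternative, and let $\nu$ be the effect size along direction $\phi$, i.e. $m(\nu)=\nu\cos\phi$ and $d(\nu)=\nu\sin\phi$. Then along direction $\phi$ the compound problem becomes the simple testing problem $H_0:\nu=0$ versus $H_1^{\phi}:\nu>0$. The Pitman efficiency $r^{\phi}(W',W^o)$ of the zero-trimmed U statistic $W'$ relative to the standard Mann–Whitney statistic with unadjusted variance $W^o$, and the Pitman efficiency $r^{\phi}(W',W)$ of $W'$ relative to the tie-adjusted Mann–Whitney statistic $W$, are $$r^{\phi}(W',W^o)=\frac{\frac13}{p^3-p^4+\frac{p^3}{3}}\left(\frac{p\cos\phi+2p^2\sin\phi}{\cos\phi+2p^2\sin\phi}\right)^2,$$ $$r^{\phi}(W',W)=\frac{1-p+\frac{p^2}{3}}{p^2-p^3+\frac{p^2}{3}}\left(\frac{p\cos\phi+2p^2\sin\phi}{\cos\phi+2p^2\sin\phi}\right)^2.$$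
   Context: Data: $\{y_{1i}\}_{i=1}^{n_1}$ i.i.d. and $\{y_{0j}\}_{j=1}^{n_0}$ i.i.d., the two samples independent, values in $[0,\infty)$, with an atom at $0$ of mass $1-p_k$ and a continuous distribution on the positive part. Under $H_0$ the two groups have the same proportion $p$ of positives and the same distribution of positive values; under the alternative $p_0=p$ and $p_1=p+m$. Asymptotics: $n_0,n_1\to\infty$ with $n_1/(n_0+n_1)$ tending to a limit in $(0,1)$. Ranks: $\kappa(\cdot)$ denotes the rank in the indicated combined sample in descending order (largest value has rank 1); tied zeros receive the average of the ranks they occupy. Mann–Whitney/Wilcoxon statistic: $W=\sum_{i=1}^{n_1}\kappa(y_{1i})-\frac{n_1(n_0+n_1+1)}{2}$, with ranks in the full combined sample. $W$ denotes this statistic used with its actual (tie-adjusted) null variance; $W^o$ denotes the same statistic used with the unadjusted variance $\frac{n_0n_1(n_0+n_1+1)}{12}$ in place of its null variance. Zero-trimmed statistic: let $n_k^+$ be the number of positive observations in sample $k$, $\hat p_k=n_k^+/n_k$, $\hat p=\max\{\hat p_0,\hat p_1\}$. Remove $n_k(1-\hat p)$ zeros from sample $k$ for $k=0,1$ (ignoring integer rounding), leaving residual samples $\{y'_{1i}\}_{i=1}^{n_1'}$ and $\{y'_{0j}\}_{j=1}^{n_0'}$ of sizes $n_k'=n_k\hat p$. With ranks in the combined residual sample, $W'=\sum_{i=1}^{n_1'}\kappa(y'_{1i})-\frac{n_1'(n_1'+n_0'+1)}{2}$. Pitman efficiency: for a statistic $S$ let $\mu_S(\nu)$ be the leading-order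 (as $n_0,n_1\to\infty$, normalized by $n_0n_1$) expectation of $S$ under effect size $\nu$ in direction $\phi$, and $\sigma_S^2(0)$ the leading-order variance of $S$ under $\nu=0$ (for $W^o$: the leading order of the unadjusted variance above), with a common normalization for all the statistics compared. Then $$r^{\phi}(S_1,S_2)=\left(\frac{\mu_{S_1}'(0)/\sigma_{S_1}(0)}{\mu_{S_2}'(0)/\sigma_{S_2}(0)}\right)^2,$$ which, for asymptotically normal statistics under local alternatives, is the limiting ratio of the sample sizes required by $S_2$ and $S_1$ to reach the same power at the same level. *)

(* Defs.v *)
From HB Require Import structures.
From mathcomp Require Import all_boot all_order all_algebra.
From mathcomp Require Import all_classical all_reals all_analysis.

Set Implicit Arguments.
Unset Strict Implicit.
Unset Printing Implicit Defensive.

Import Order.TTheory GRing.Theory Num.Theory.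
Import numFieldNormedType.Exports.

Local Open Scope classical_set_scope.
Local Open Scope ring_scope.

Section RankStatistics.
Variable R : realType.
Implicit Types (s : seq R) (rnd : R -> nat).

(* Descending rank of the value x in the sample s. Equal values share the
   average of the (1-based) positions that they occupy in the sorted sample. *)
Definition avg_rank s (x : R) : R :=
  let t := sort >=%R s in
  (\sum_(r < size t | t`_r == x) r.+1%:R) / (count_mem x s)%:R.

Definition mann_whitney (s1 s0 : seq R) : R :=
  let n1 : R := (size s1)%:R in let n0 : R := (size s0)%:R in
  \sum_(x <- s1) avg_rank (s1 ++ s0) x - n1 * (n0 + n1 + 1) / 2.

Definition unadjusted_var (n1 n0 : nat) : R :=
  n0%:R * n1%:R * (n0%:R + n1%:R + 1) / 12.

Definition pos_proportion s : R := (count [pred x | 0 < x] s)%:R / (size s)%:R.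

(* The number of zeros to be removed from a sample is in general not an
   integer. A rounding rule turns it into a neighbouring integer, and leaves it
   unchanged when it is an integer already. *)
Definition rounding_rule rnd : Prop :=
  forall x : R, 0 <= x -> `|(rnd x)%:R - x| < 1.

(* rem 0 s deletes one occurrence of 0 from s *)
Definition trim rnd (q : R) s : seq R :=
  iter (rnd ((size s)%:R * (1 - q))) (rem 0) s.

Definition zero_trimmed rnd (s1 s0 : seq R) : R :=
  let q := Num.max (pos_proportion s0) (pos_proportion s1) in
  mann_whitney (trim rnd q s1) (trim rnd q s0).

End RankStatistics.

Section Model.
Context d (T : measurableType d) (R : realType).
Implicit Types (P : probability T R) (X : {mfun T >-> R}).

Definition mutually_independent P (I : eqType) (X : I -> {mfun T >-> R}) : Prop :=
  forall (s : seq I) (A : I -> set R), uniq s -> (forall i, measurable (A i)) ->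
  P (\bigcap_(i in [set` s]) X i @^-1` A i) =
  (\prod_(i <- s) P (X i @^-1` A i))%E.

Definition prob_pos P X : R := fine (P (X @^-1` `]0, +oo[)).

(* Values in [0, +oo[, and no atom other than 0; the mass of the atom 0 is then
   1 - prob_pos P X. *)
Definition zero_inflated P X : Prop :=
  P (X @^-1` `]-oo, 0[) = 0%E /\ forall x : R, 0 < x -> P (X @^-1` [set x]) = 0%E.

(* Conditional distribution of X given X > 0; the Dirac mass is a junk value,
   used only if P (X > 0) = 0. *)
Definition pos_law P X : probability R R :=
  mnormalize (mrestr (distribution P X) (measurable_itv `]0, +oo[)) (\d_(0 : R)).

(* P (X1+ > X0+) - 1/2, for independent X1+ and X0+ *)
Definition pos_shift P X1 X0 : R :=
  fine ((pos_law P X1 \x pos_law P X0)%E [set z : R * R | z.2 < z.1]) - 2^-1.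

(* Y true i and Y false j are the observations y_1i and y_0j. *)
Definition two_samples P (Y : bool -> nat -> {mfun T >-> R}) : Prop :=
  [/\ mutually_independent P (fun ki : bool * nat => Y ki.1 ki.2),
      (forall k i (A : set R), measurable A ->
         distribution P (Y k i) A = distribution P (Y k 0%N) A) &
      forall k, zero_inflated P (Y k 0%N)].

Definition incidence_effect P (Y : bool -> nat -> {mfun T >-> R}) : R :=
  prob_pos P (Y true 0%N) - prob_pos P (Y false 0%N).

Definition intensity_effect P (Y : bool -> nat -> {mfun T >-> R}) : R :=
  pos_shift P (Y true 0%N) (Y false 0%N).

Definition on_samples (Y : bool -> nat -> {mfun T >-> R})
    (S : seq R -> seq R -> R) (n1 n0 : nat) : T -> R :=
  fun w => S (mkseq (fun i => Y true i w) n1) (mkseq (fun j => Y false j w) n0).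

Definition stat_mean P Y S (n1 n0 : nat) : R := fine ('E_P[on_samples Y S n1 n0])%E.

Definition stat_var P Y S (n1 n0 : nat) : R := fine ('V_P[on_samples Y S n1 n0])%E.

End Model.

Section Pitman.
Variable R : realType.

Definition null_hyp (m d : R) : Prop := m = 0 /\ d = 0.

Definition alt_hyp (m d : R) : Prop :=
  (1 - (0 < m)%R%:R) * (1 - (0 < d)%R%:R) = 0 :> R.

(* c = mu'(0) / sigma(0) along the sample sizes n1 k, n0 k, where mean nu is
   the expectation of the statistic under the effect size nu, and var is its
   variance under nu = 0. The effect size ranges over V only, so mu'(0) is a
   derivative within V. The variance is normalized by n0 n1 (n0 + n1), for all
   statistics alike. *)
Definition is_efficacy (V : set R) (n1 n0 : nat -> nat)
    (mean : R -> nat -> nat -> R) (var : nat -> nat -> R) (c : R) : Prop :=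
  exists (mu : R -> R) (mu' sigma : R),
  [/\ forall nu, V nu ->
        (mean nu (n1 k) (n0 k) / ((n0 k)%:R * (n1 k)%:R)) @[k --> \oo] --> mu nu,
      ((mu nu - mu 0) / nu) @[nu --> within V (0 : R)^'] --> mu',
      0 < sigma,
      (var (n1 k) (n0 k) /
        ((n0 k)%:R * (n1 k)%:R * ((n0 k)%:R + (n1 k)%:R))) @[k --> \oo]
        --> sigma ^+ 2 &
      c = mu' / sigma].

Definition is_pitman_efficiency (V : set R) (n1 n0 : nat -> nat)
    (mean1 : R -> nat -> nat -> R) (var1 : nat -> nat -> R)
    (mean2 : R -> nat -> nat -> R) (var2 : nat -> nat -> R) (r : R) : Prop :=
  exists c1 c2 : R,
  [/\ is_efficacy V n1 n0 mean1 var1 c1, is_efficacy V n1 n0 mean2 var2 c2,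
      c2 != 0 & r = (c1 / c2) ^+ 2].

End Pitman.

(* Main.v *)
Require Import Defs.
From HB Require Import structures.
From mathcomp Require Import all_boot all_order all_algebra.
From mathcomp Require Import all_classical all_reals all_analysis.
From mathcomp Require Import measurable_realfun ring lra zify.
Import Order.TTheory GRing.Theory Num.Theory.
Import numFieldNormedType.Exports.
Local Open Scope classical_set_scope.
Local Open Scope ring_scope.

(** Up to the factor 1/2, the Mann-Whitney statistic is the sum of the signs of
    y_0j - y_1i over all pairs. For nonnegative data this is A + B, where A
    collects the pairs of positive observations and
    B = n_1 n_0^+ - n_0 n_1^+ compares the counts of positive observations.
    Removing zeros replaces B by q B, where q is the larger of the two observed
    proportions, up to a rounding error of at most n_0 + n_1. So the mean slopes
    differ only in the weight of the incidence effect: 1 for W and p for W'.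
    Under the null hypothesis all observations are exchangeable, hence A and B
    are uncorrelated and centered, E B^2 = n_0 n_1 (n_0 + n_1) p (1 - p), and
    E A^2 ~ n_0 n_1 (n_0 + n_1) p^3 / 3. Replacing q by p costs O((n_0 + n_1)^2)
    in second moment, by a fourth moment bound on the counts, whereas the
    variances are of cubic order. *)

(** * Rank statistics as sums of signs *)

(** No integral against the unknown law of the positive values is computed. The constant p^3 / 3 is
    a symmetry effect: two sign kernels sharing one index have the same mean for each of the three
    choices of that index, and the three products add up almost surely to the indicator that all
    three values are positive. The obstacle is q, a maximum that depends on B. With a, b the two
    observed proportions, B = n_0 n_1 (a - b), and both |q - p| and |a - b| are at most |a - p| + |b
    - p|. So (q - p) B has degree two in the deviations and its square degree four. The covariance
    of this remainder with A + p B is bounded with a free weight t, later taken as sqrt (1 / n_0 + 1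
    / n_1). Away from the null the limiting mean of W' contains max (p_0, p_1) (p_1 - p_0). The kink
    of the maximum sits where the other factor vanishes, so this product still has derivative p cos
    phi at nu = 0. Nonnegativity and the absence of positive ties hold only almost surely, and the
    rounding rule is an arbitrary function, so measurability of W' needs its own argument. *)

Lemma sum_ranks_sorted (R : realType) (x : R) (t : seq R) : sorted >=%R t ->
  \sum_(r < size t | t`_r == x) r.+1%:R =
  (count_mem x t)%:R * ((count (> x) t)%:R + ((count_mem x t)%:R + 1) / 2) :> R.
Proof.
elim: t => [|y t IH] /= pt; first by rewrite big_ord0 mul0r.
have /IH {}IH := path_sorted pt.
have all_le : all (<= y) t by apply: order_path_min pt => a b c ab bc; exact: le_trans bc ab.
rewrite big_mkcond big_ord_recl /= -big_mkcond /=.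
have -> : \sum_(i < size t | t`_i == x) (bump 0 i).+1%:R =
          (count_mem x t)%:R + \sum_(i < size t | t`_i == x) i.+1%:R :> R.
  have -> : (count_mem x t)%:R = \sum_(i < size t | t`_i == x) 1 :> R.
    rewrite -sum1_count natr_sum (big_nth 0) big_mkord.
    by apply: eq_bigl => i.
  by rewrite -big_split; apply: eq_bigr => i _; rewrite /= /bump /= add1n -natr1 addrC.
(* The copies of [x] fill the consecutive positions after the larger entries. The head [y] is
   maximal: if it is below [x], then [x] is absent from the tail; if it equals [x], nothing in the
   tail exceeds [x]. *)
rewrite IH; case: (ltgtP y x) => [yx|xy|xE] /=.
- have -> : count_mem x t = 0%N.
    apply/eqP; rewrite -leqn0 leqNgt -has_count; apply/negP => /hasP[z /(allP all_le) zy /eqP zx].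
    by move: zy; rewrite /= zx leNgt yx.
  by rewrite !(mul0r, addr0).
- by rewrite !natrD; ring.
- have -> : count (> x) t = 0%N.
    apply/eqP; rewrite -leqn0 leqNgt -has_count; apply/negP => /hasP[z /(allP all_le) zy zx].
    by move: zy zx; rewrite /= ltNge -xE => ->.
  by rewrite !natrD; field.
Qed.

(** In descending order a larger entry pushes [x] down by 1 and an equal one by 1/2 on average. The
    entry [x] itself supplies one half, which the final [2^-1] completes to 1. *)
Lemma avg_rankE (R : realType) (s : seq R) (x : R) : x \in s ->
  avg_rank s x = \sum_(z <- s) (1 + Num.sg (z - x)) / 2 + 2^-1.
Proof.
move=> xs; rewrite /avg_rank sum_ranks_sorted; last first.
  by apply: sort_sorted => a b; rewrite orbC; exact: le_total.
rewrite !(count_sort, permP (permEl (perm_sort _ _))).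
have c0 : (count_mem x s)%:R != 0 :> R by rewrite pnatr_eq0 -lt0n -has_count has_pred1.
transitivity ((count (> x) s)%:R + (count_mem x s)%:R / 2 + 2^-1 : R).
  by field.
congr (_ + _); rewrite -!sum1_count !natr_sum (big_mkcond (> x)) (big_mkcond (pred1 x)).
rewrite mulr_suml -big_split /=; apply: eq_bigr => z _.
case: (ltgtP x z) => xz.
- by rewrite gtr0_sg ?subr_gt0 //; field.
- by rewrite ltr0_sg ?subr_lt0 //; ring.
- by rewrite xz subrr sgr0; ring.
Qed.

Lemma sum_sg_antisym (R : realType) (s : seq R) :
  \sum_(x <- s) \sum_(z <- s) Num.sg (z - x) = 0 :> R.
Proof.
set S := LHS; suff : S = - S by lra.
rewrite {1}/S exchange_big /= -sumrN; apply: eq_bigr => x _.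
by rewrite -sumrN; apply: eq_bigr => z _; rewrite -opprB sgrN.
Qed.

(** Comparisons inside sample 1 cancel by antisymmetry, and the constant parts of the ranks add up
    to the subtracted centering, so only the signs across the samples survive. *)
Lemma mann_whitneyE (R : realType) (s1 s0 : seq R) :
  mann_whitney s1 s0 = (\sum_(x <- s1) \sum_(y <- s0) Num.sg (y - x)) / 2.
Proof.
rewrite /mann_whitney (eq_big_seq (fun x => (\sum_(z <- s1) Num.sg (z - x) +
   \sum_(y <- s0) Num.sg (y - x) + ((size s1)%:R + (size s0)%:R + 1)) / 2)); last first.
  move=> x xs; rewrite avg_rankE ?mem_cat ?xs // big_cat /= -!mulr_suml.
  by rewrite !big_split /= !big_const_seq !count_predT !iter_addr_0; field.
rewrite -mulr_suml !big_split /= sum_sg_antisym !big_const_seq !count_predT !iter_addr_0.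
by rewrite -[(size s1)%:R *+ _]mulr_natl -[(size s0)%:R *+ _]mulr_natl; field.
Qed.

(** Once no zero is left, [rem 0] does nothing; hence the [minn]. *)
Lemma big_iter_rem0 (R : realType) (f : R -> R) r (s : seq R) :
  \sum_(x <- iter r (rem 0) s) f x =
  \sum_(x <- s) f x - (minn r (count_mem 0 s))%:R * f 0.
Proof.
elim: r s => [|r IH] s; first by rewrite min0n mul0r subr0.
rewrite iterSr IH count_rem; have [s0|s0] := boolP (0 \in s).
  rewrite [\sum_(x <- s) _](perm_big _ (perm_to_rem s0)) big_cons /=.
  have : (0 < count_mem 0%R s)%N by rewrite -has_count has_pred1.
  case: (count_mem 0 s) => // n _; rewrite eqxx subn1 /= minnSS -natr1; ring.
rewrite rem_id // subn0 (count_memPn s0) !minn0; ring.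
Qed.

(** Trimming is bilinear: a zero removed from one sample takes away its signs against the other
    sample, and pairs of removed zeros contribute [Num.sg 0], which vanishes. *)
Lemma zero_trimmedE (R : realType) rnd (s1 s0 : seq R) :
  let q := Num.max (pos_proportion s0) (pos_proportion s1) in
  let r s := (minn (rnd ((size s)%:R * (1 - q))) (count_mem 0 s))%:R in
  zero_trimmed rnd s1 s0 =
  (\sum_(x <- s1) \sum_(y <- s0) Num.sg (y - x)
   - r s1 * (\sum_(y <- s0) Num.sg y) + r s0 * (\sum_(x <- s1) Num.sg x)) / 2.
Proof.
move=> q r; rewrite /zero_trimmed mann_whitneyE /trim -/q; congr (_ / 2).
rewrite big_iter_rem0 -/(r s1).
under eq_bigr do rewrite big_iter_rem0 -/(r s0) sub0r sgrN mulrN opprK.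
under [X in _ - _ * X]eq_bigr do rewrite subr0.
rewrite big_split /= -mulr_sumr big_iter_rem0 -/(r s0) sgr0; ring.
Qed.

(** * Expectation of bounded random variables *)

(** At fixed sample sizes all variables involved are bounded. This class is stable under ring
    operations, norms and maxima and is integrable for every probability, so the rules for [Ex] ask
    for nothing else. *)
Definition bounded_meas {d} {T : measurableType d} {R : realType} (f : T -> R) : Prop :=
  measurable_fun [set: T] f /\ exists M : R, forall w, `|f w| <= M.

Definition Ex {d} {T : measurableType d} {R : realType} (P : probability T R)
  (f : T -> R) : R := fine ('E_P[f])%E.

Section BoundedMeas.
Context {d} {T : measurableType d} {R : realType}.
Implicit Types f g : T -> R.

Lemma bm_cst (c : R) : bounded_meas (fun _ : T => c).
Proof. by split; [exact: measurable_cst|exists `|c|]. Qed.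

Lemma bmD {f g} : bounded_meas f -> bounded_meas g -> bounded_meas (fun w => f w + g w).
Proof.
move=> [mf [M fM]] [mg [N gN]]; split; first exact: measurable_funD.
by exists (M + N) => w; rewrite (le_trans (ler_normD _ _)) ?lerD.
Qed.

Lemma bmM {f g} : bounded_meas f -> bounded_meas g -> bounded_meas (fun w => f w * g w).
Proof.
move=> [mf [M fM]] [mg [N gN]]; split; first exact: measurable_funM.
by exists (M * N) => w; rewrite normrM ler_pM.
Qed.

Lemma bmZ {f} c : bounded_meas f -> bounded_meas (fun w => c * f w).
Proof. by move=> bf; exact: bmM (bm_cst c) bf. Qed.

Lemma bmN {f} : bounded_meas f -> bounded_meas (fun w => - f w).
Proof.
move=> [mf [M fM]]; split; first exact: measurableT_comp.
by exists M => w; rewrite normrN.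
Qed.

Lemma bmB {f g} : bounded_meas f -> bounded_meas g -> bounded_meas (fun w => f w - g w).
Proof. by move=> bf bg; exact: bmD bf (bmN bg). Qed.

Lemma bmX {f} n : bounded_meas f -> bounded_meas (fun w => f w ^+ n).
Proof.
move=> bf; elim: n => [|n IH]; first exact: (bm_cst 1).
by under eq_fun do rewrite exprS; exact: bmM.
Qed.

Lemma bm_norm {f} : bounded_meas f -> bounded_meas (fun w => `|f w|).
Proof.
move=> [mf [M fM]]; split; first exact: measurableT_comp.
by exists M => w; rewrite normr_id.
Qed.

Lemma bm_max {f g} : bounded_meas f -> bounded_meas g ->
  bounded_meas (fun w => Num.max (f w) (g w)).
Proof.
move=> [mf [M fM]] [mg [N gN]]; split; first exact: measurable_maxr.
exists (Num.max M N) => w; rewrite le_max /Num.max.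
by case: ifP => _; rewrite ?fM ?gN ?orbT.
Qed.

Lemma bm_sum {I : Type} (s : seq I) (F : I -> T -> R) :
  (forall i, bounded_meas (F i)) -> bounded_meas (fun w => \sum_(i <- s) F i w).
Proof.
move=> bF; elim: s => [|i s IH].
  by under eq_fun do rewrite big_nil; exact: bm_cst.
by under eq_fun do rewrite big_cons; exact: bmD.
Qed.

Lemma bm_comp {d'} {T' : measurableType d'} (f : T' -> R) (Z : T -> T') :
  measurable_fun setT Z -> bounded_meas f -> bounded_meas (fun w => f (Z w)).
Proof.
move=> mZ [mf [M fM]]; split; last by exists M.
exact: measurableT_comp.
Qed.

Context (P : probability T R).

Lemma bm_integrable {f} : bounded_meas f -> P.-integrable setT (EFin \o f).
Proof.
move=> [mf [M fM]]; apply: measurable_bounded_integrable => //.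
  by rewrite /= probability_setT ltry.
exists M; split; first by rewrite num_real.
by move=> N MN w _; rewrite /= (le_trans (fM w)) ?ltW.
Qed.

Lemma ExE f : Ex P f = \int[P]_w f w.
Proof. by rewrite /Ex unlock. Qed.

Lemma Ex_cst c : Ex P (fun=> c) = c.
Proof. by rewrite /Ex expectation_cst. Qed.

Lemma ExD {f g} : bounded_meas f -> bounded_meas g ->
  Ex P (fun w => f w + g w) = Ex P f + Ex P g.
Proof. by move=> bf bg; rewrite !ExE RintegralD //; exact: bm_integrable. Qed.

Lemma ExZ {f} c : bounded_meas f -> Ex P (fun w => c * f w) = c * Ex P f.
Proof. by move=> bf; rewrite !ExE RintegralZl //; exact: bm_integrable. Qed.

Lemma ExN {f} : bounded_meas f -> Ex P (fun w => - f w) = - Ex P f.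
Proof.
move=> bf; rewrite -mulN1r -ExZ //; congr Ex.
by apply/funext => w; rewrite mulN1r.
Qed.

Lemma ExB {f g} : bounded_meas f -> bounded_meas g ->
  Ex P (fun w => f w - g w) = Ex P f - Ex P g.
Proof. by move=> bf bg; rewrite ExD ?ExN //; exact: bmN. Qed.

Lemma Ex_sum {I : Type} (s : seq I) (F : I -> T -> R) :
  (forall i, bounded_meas (F i)) ->
  Ex P (fun w => \sum_(i <- s) F i w) = \sum_(i <- s) Ex P (F i).
Proof.
move=> bF; elim: s => [|i s IH].
  by under eq_fun do rewrite big_nil; rewrite big_nil Ex_cst.
by under eq_fun do rewrite big_cons; rewrite big_cons ExD ?IH //; exact: bm_sum.
Qed.

Lemma Ex_le {f g} : bounded_meas f -> bounded_meas g -> (forall w, f w <= g w) ->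
  Ex P f <= Ex P g.
Proof.
by move=> bf bg fg; rewrite !ExE le_Rintegral //; exact: bm_integrable.
Qed.

Lemma Ex_ge0 f : (forall w, 0 <= f w) -> 0 <= Ex P f.
Proof. by move=> f0; rewrite ExE; exact: Rintegral_ge0. Qed.

Lemma Ex_norm {f} : bounded_meas f -> `|Ex P f| <= Ex P (fun w => `|f w|).
Proof.
move=> bf; rewrite !ExE; apply: le_normr_Rintegral => //; exact: bm_integrable.
Qed.

Lemma Ex_ae {f g} : bounded_meas f -> bounded_meas g ->
  {ae P, forall w, f w = g w} -> Ex P f = Ex P g.
Proof.
move=> [mf _] [mg _] fg; rewrite !ExE /Rintegral; congr fine.
apply: ae_eq_integral => //; [exact/measurable_EFinP|exact/measurable_EFinP|].
by apply: filterS fg => w -> _.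
Qed.

Lemma Ex_ae_le {f g} : bounded_meas f -> bounded_meas g ->
  {ae P, forall w, f w <= g w} -> Ex P f <= Ex P g.
Proof.
move=> bf bg fg; have bgf := bmB bg bf.
rewrite -subr_ge0 -ExB // (Ex_ae bgf (bm_norm bgf)); first exact: Ex_ge0.
by apply: filterS fg => w; rewrite -subr_ge0 => /ger0_norm.
Qed.

(* AM-GM; stands in for Cauchy-Schwarz and avoids square roots. *)
Lemma Ex_mul_le {f g} (t : R) : 0 < t -> bounded_meas f -> bounded_meas g ->
  `|Ex P (fun w => f w * g w)| <=
    (t * Ex P (fun w => f w ^+ 2) + Ex P (fun w => g w ^+ 2) / t) / 2.
Proof.
move=> t0 bf bg; apply: le_trans (Ex_norm (bmM bf bg)) _.
have b2f := bmX 2 bf; have b2g := bmX 2 bg.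
rewrite -[_ / t]mulrC -ExZ // -ExZ // -ExD; [|exact: bmZ|exact: bmZ].
rewrite -[_ / 2]mulrC -ExZ; last by apply: bmD; exact: bmZ.
apply: Ex_le; first exact/bm_norm/bmM.
  by apply/bmZ/bmD; exact: bmZ.
move=> w; rewrite normrM -[f w ^+ 2]real_normK ?num_real // -[g w ^+ 2]real_normK ?num_real //.
have -> : 2^-1 * (t * `|f w| ^+ 2 + t^-1 * `|g w| ^+ 2) =
   `|f w| * `|g w| + (t * `|f w| - `|g w|) ^+ 2 / (2 * t) by field; rewrite gt_eqF.
by rewrite lerDl divr_ge0 ?sqr_ge0 // mulr_ge0 // ltW.
Qed.

Lemma fine_varE {f} : bounded_meas f ->
  fine ('V_P[f])%E = Ex P (fun w => f w ^+ 2) - Ex P f ^+ 2.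
Proof.
move=> bf; rewrite /variance covariance.unlock /covariance.body -/(Ex P f).
set m := Ex P f.
transitivity (Ex P (fun w => f w ^+ 2 + (- (2 * m)) * f w + m ^+ 2)).
  by congr (fine (expectation _ _)); apply/funext => w; rewrite !fctE /=; ring.
rewrite -/(Ex P _) !ExD ?Ex_cst ?ExZ; do ?[exact: bmX|exact: bm_cst|exact: bmZ|exact: bf].
- rewrite -/m; ring.
- by apply: bmD; [exact: bmX|exact: bmZ].
Qed.

Lemma Ex_sqr_le {f} : bounded_meas f -> Ex P f ^+ 2 <= Ex P (fun w => f w ^+ 2).
Proof.
move=> bf; rewrite -subr_ge0 -fine_varE //; exact/fine_ge0/variance_ge0.
Qed.

End BoundedMeas.

Ltac bounded := repeat first
  [ assumption | exact: bm_cst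
  | match goal with
    | |- bounded_meas (fun _ => \sum_(i <- _) _) => apply: bm_sum => ?
    | |- bounded_meas (fun _ => _ + - _) => apply: bmB
    | |- bounded_meas (fun _ => _ + _) => apply: bmD
    | |- bounded_meas (fun _ => - _) => apply: bmN
    | |- bounded_meas (fun _ => _ * _) => apply: bmM
    | |- bounded_meas (fun _ => _ ^+ _) => apply: bmX
    | |- bounded_meas (fun _ => Num.max _ _) => apply: bm_max
    | |- bounded_meas (fun _ => `|_|) => apply: bm_norm
    end
  | solve [eauto 2 with bounded] ].
Create HintDb bounded.

(** * Joint laws *)

Definition pair_fun {d d1 d2} {T : measurableType d} {T1 : measurableType d1}
  {T2 : measurableType d2} (f : {mfun T >-> T1}) (g : {mfun T >-> T2}) (w : T) :=
  (f w, g w).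

HB.instance Definition _ {d d1 d2} {T : measurableType d} {T1 : measurableType d1}
    {T2 : measurableType d2} (f : {mfun T >-> T1}) (g : {mfun T >-> T2}) :=
  isMeasurableFun.Build _ _ _ _ (pair_fun f g)
    (measurable_fun_pair (measurable_funPT f) (measurable_funPT g)).

(** Rectangles form a pi-system that generates the product sigma-algebra, and the total mass is
    finite. *)
Lemma measure_rectangle_unique {R : realType} d1 d2 (T1 : measurableType d1)
    (T2 : measurableType d2) (m m' : {measure set (T1 * T2) -> \bar R}) :
  (m setT < +oo)%E ->
  (forall A B, measurable A -> measurable B -> m (A `*` B) = m' (A `*` B)) ->
  forall E, measurable E -> m E = m' E.
Proof.
move=> moo mm' E mE.
pose G : set (set (T1 * T2)) := [set A `*` B | A in measurable & B in measurable].
apply: (measure_unique G (fun=> setT)) => //.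
- by rewrite measurable_prod_measurableType.
- move=> _ _ [A1 mA1 [B1 mB1 <-]] [A2 mA2 [B2 mB2 <-]]; rewrite -setXI.
  by exists (A1 `&` A2); [exact: measurableI|exists (B1 `&` B2) => //; exact: measurableI].
- by move=> _; exists setT => //; exists setT => //; rewrite setXTT.
- by rewrite bigcup_const //; exists 0%N.
- by move=> _ [A mA [B mB <-]]; exact: mm'.
Qed.

(** Stated for finite measures, not only probabilities, so that it can be applied to restrictions of
    [P] to an event. *)
Lemma joint_unique {R : realType} d d1 d2 (T : measurableType d) (T1 : measurableType d1)
    (T2 : measurableType d2) (m m' : {measure set T -> \bar R})
    (f f' : {mfun T >-> T1}) (g g' : {mfun T >-> T2}) :
  (m setT < +oo)%E ->
  (forall A B, measurable A -> measurable B ->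
     m (f @^-1` A `&` g @^-1` B) = m' (f' @^-1` A `&` g' @^-1` B)) ->
  forall E, measurable E -> m (pair_fun f g @^-1` E) = m' (pair_fun f' g' @^-1` E).
Proof.
move=> moo mm' E mE.
exact: (@measure_rectangle_unique R d1 d2 T1 T2
  (pushforward m (pair_fun f g)) (pushforward m' (pair_fun f' g')) moo mm').
Qed.

(** One coordinate is peeled off at a time: fixing the event of the first variable amounts to
    restricting [P] to it, and [joint_unique] then applies to the remaining ones. *)
Lemma quadruple_unique {R : realType} d (T : measurableType d) (P : probability T R)
    (a b c e a' b' c' e' : {mfun T >-> R}) :
  (forall A B C D, measurable A -> measurable B -> measurable C -> measurable D ->
     P (a @^-1` A `&` (b @^-1` B `&` (c @^-1` C `&` e @^-1` D))) =
     P (a' @^-1` A `&` (b' @^-1` B `&` (c' @^-1` C `&` e' @^-1` D)))) ->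
  forall E, measurable E ->
  P (pair_fun a (pair_fun b (pair_fun c e)) @^-1` E) =
  P (pair_fun a' (pair_fun b' (pair_fun c' e')) @^-1` E).
Proof.
move=> PE; apply: joint_unique => [|A E1 mA mE1]; first by rewrite /= probability_setT ltry.
have Poo E : measurable E -> (P E < +oo)%E.
  by move=> mE; rewrite (le_lt_trans (probability_le1 P mE)) ?ltry.
have mpre (X : {mfun T >-> R}) A' : measurable A' -> measurable (X @^-1` A').
  by move=> mA'; rewrite -[X in measurable X]setTI; exact: measurable_funPT.
have ma := mpre a A mA; have ma' := mpre a' A mA.
have := @joint_unique R _ _ _ T _ _ (mrestr P ma) (mrestr P ma') b b'
  (pair_fun c e) (pair_fun c' e') _ _ E1 mE1.
rewrite /= /mrestr ![_ `&` (_ @^-1` A)]setIC; apply; first by rewrite setIT; exact: Poo.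
move=> B E2 mB mE2.
have mb := measurableI _ _ ma (mpre b B mB); have mb' := measurableI _ _ ma' (mpre b' B mB).
have := @joint_unique R _ _ _ T _ _ (mrestr P mb) (mrestr P mb') c c' e e' _ _ E2 mE2.
rewrite /= /mrestr.
rewrite ![_ `&` (a @^-1` A)]setIC ![_ `&` (a' @^-1` A)]setIC.
rewrite ![_ `&` (a @^-1` A `&` _)]setIC ![_ `&` (a' @^-1` A `&` _)]setIC -!setIA.
apply; first by rewrite !setIA setIT; exact: Poo.
by move=> C D mC mD; rewrite ![_ `&` (a @^-1` A `&` _)]setIC ![_ `&` (a' @^-1` A `&` _)]setIC -!setIA PE.
Qed.

(** * Independence, exchangeability and products of positivity indicators *)

Definition pos {R : realType} (x : R) : R := (0 < x)%R%:R.

Section Independent.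
Context {d} {T : measurableType d} {R : realType} (P : probability T R).
Context {I : eqType} (X : I -> {mfun T >-> R}).
Hypothesis indep : mutually_independent P X.
Implicit Types (i j k l : I) (s t : seq I).

Lemma measurable_preimage i (A : set R) : measurable A -> measurable (X i @^-1` A).
Proof. by move=> mA; rewrite -[X in measurable X]setTI; exact: measurable_funPT. Qed.

Lemma bigcap_cons i s (F : I -> set T) :
  \bigcap_(j in [set` i :: s]) F j = F i `&` \bigcap_(j in [set` s]) F j.
Proof.
apply/seteqP; split => [w Fw|w [Fi Fs] j /=].
  by split => [|j js]; apply: Fw; rewrite /= inE ?eqxx // (js : j \in s) orbT.
by rewrite inE => /orP[/eqP ->//|js]; exact: Fs.
Qed.

Lemma bigcap_nil (F : I -> set T) : \bigcap_(j in [set` [::]]) F j = setT.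
Proof. by apply/seteqP; split. Qed.

Lemma indep2 i j (A B : set R) : i != j -> measurable A -> measurable B ->
  P (X i @^-1` A `&` X j @^-1` B) = (P (X i @^-1` A) * P (X j @^-1` B))%E.
Proof.
move=> ij mA mB.
have := @indep [:: i; j] (fun k => if k == i then A else B).
rewrite !bigcap_cons bigcap_nil !big_cons !big_nil /= setIT mule1 eqxx (negPf (_ : j != i)) 1?eq_sym //.
by apply; [rewrite /= inE ij|move=> k; case: ifP].
Qed.

Lemma indep4 i j k l (A B C D : set R) : uniq [:: i; j; k; l] ->
  measurable A -> measurable B -> measurable C -> measurable D ->
  P (X i @^-1` A `&` (X j @^-1` B `&` (X k @^-1` C `&` X l @^-1` D))) =
  (P (X i @^-1` A) * (P (X j @^-1` B) * (P (X k @^-1` C) * P (X l @^-1` D))))%E.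
Proof.
move=> u mA mB mC mD.
have := @indep _ (fun m => if m == i then A else if m == j then B else
  if m == k then C else D) u.
rewrite !bigcap_cons bigcap_nil !big_cons !big_nil /= setIT mule1 !eqxx.
move: u; rewrite /= !inE !negb_or !andbT => /andP[/and3P[ij ik il] /andP[/andP[jk jl] kl]].
rewrite ![_ == i]eq_sym ![_ == j]eq_sym [l == k]eq_sym [j == i]eq_sym.
rewrite (negPf ij) (negPf ik) (negPf il) (negPf jk) (negPf jl) (negPf kl).
by apply => m; do 3?case: ifP.
Qed.

Definition same_law i j :=
  forall A : set R, measurable A -> P (X i @^-1` A) = P (X j @^-1` A).

(** By independence the joint law depends on the marginal laws alone. Four indices suffice because
    the square of a double sum involves two pairs at a time. *)
Lemma exchangeable (h : R -> R -> R -> R -> R) i j k l i' j' k' l' :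
  same_law i i' -> same_law j j' -> same_law k k' -> same_law l l' ->
  uniq [:: i; j; k; l] -> uniq [:: i'; j'; k'; l'] ->
  bounded_meas (fun z : R * (R * (R * R)) => h z.1 z.2.1 z.2.2.1 z.2.2.2) ->
  Ex P (fun w => h (X i w) (X j w) (X k w) (X l w)) =
  Ex P (fun w => h (X i' w) (X j' w) (X k' w) (X l' w)).
Proof.
move=> si sj sk sl u u' bh; set H := (fun z => _) in bh.
pose Z i j k l := pair_fun (X i) (pair_fun (X j) (pair_fun (X k) (X l))).
have pf a b c e : Ex P (H \o Z a b c e) =
    fine (\int[pushforward P (Z a b c e)]_z (H z)%:E).
  rewrite integral_pushforward //; first by rewrite ExE.
    by apply/measurable_EFinP; case: bh.
  exact: (bm_integrable P (bm_comp H _ (measurable_funPT (Z a b c e)) bh)).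
rewrite -[LHS]/(Ex P (H \o Z i j k l)) -[RHS]/(Ex P (H \o Z i' j' k' l')) !pf.
congr fine; apply: eq_measure_integral => E mE _.
apply: quadruple_unique mE => A B C D mA mB mC mD.
by rewrite !indep4 // (si A) // (sj B) // (sk C) // (sl D).
Qed.

Lemma bm_pos : bounded_meas (@pos R).
Proof.
split; last by exists 1 => x; rewrite /pos; case: (0 < x); rewrite ?normr1 ?normr0.
have -> : @pos R = \1_`]0, +oo[.
  by apply/funext => x; rewrite indicE /pos mem_setE in_itv /= andbT.
by apply: measurable_indic; exact: measurable_itv.
Qed.

Lemma bm_posX i : bounded_meas (fun w => pos (X i w)).
Proof. exact: bm_comp (measurable_funPT _) bm_pos. Qed.

Lemma bm_prod s (F : I -> T -> R) : (forall i, bounded_meas (F i)) ->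
  bounded_meas (fun w => \prod_(i <- s) F i w).
Proof.
move=> bF; elim: s => [|i s IH]; first by under eq_fun do rewrite big_nil; exact: bm_cst.
by under eq_fun do rewrite big_cons; exact: bmM.
Qed.

(** Indicators are idempotent, so a repeated index counts once; hence [undup]. *)
Lemma Ex_prod_pos s :
  Ex P (fun w => \prod_(i <- s) pos (X i w)) = \prod_(i <- undup s) prob_pos P (X i).
Proof.
have mpos i : measurable (X i @^-1` `]0, +oo[).
  by apply: measurable_preimage; exact: measurable_itv.
have -> : (fun w => \prod_(i <- s) pos (X i w)) =
    \1_(\bigcap_(i in [set` undup s]) X i @^-1` `]0, +oo[) :> (T -> R).
  apply/funext => w; rewrite indicE.
  transitivity ((all (fun i => 0 < X i w)%R s)%:R : R).
    by elim: s => [|i s IH]; rewrite ?big_nil ?big_cons //= IH -natrM mulnb.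
  congr (_%:R); congr nat_of_bool; apply/idP/idP.
    move=> /allP si; rewrite inE => i /=; rewrite mem_undup => /si.
    by rewrite in_itv /= andbT.
  rewrite inE => si; apply/allP => i is_; have := si i.
  by rewrite /= mem_undup in_itv /= andbT; apply.
rewrite /Ex expectation_indic; last first.
  by elim: (undup s) => [|i t IH]; rewrite ?bigcap_nil ?bigcap_cons //; exact: measurableI.
rewrite (@indep _ (fun=> [set` `]0, +oo[])) ?undup_uniq //.
elim: (undup s) => [|i t IH]; rewrite ?big_nil ?big_cons //.
rewrite fineM ?IH // ?fin_num_measure //.
by elim: t {IH} => [|j t IH]; rewrite ?big_nil ?big_cons // fin_numM ?fin_num_measure.
Qed.

Definition centered i (w : T) : R := pos (X i w) - prob_pos P (X i).

Lemma bm_centered i : bounded_meas (centered i).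
Proof. by apply: bmB; [exact: bm_posX|exact: bm_cst]. Qed.

(** Each centered factor is expanded into an indicator minus a constant, which moves its index from
    [t] to [s]; this is why the statement carries both lists. With [t] empty, [Ex_prod_pos] makes
    the two terms cancel. *)
Lemma Ex_centered_prod i s t : i \notin s ++ t ->
  Ex P (fun w => centered i w *
    (\prod_(j <- s) pos (X j w) * \prod_(k <- t) centered k w)) = 0.
Proof.
elim: t s => [|k t IH] s; rewrite ?cats0 => ni.
  transitivity (Ex P (fun w => \prod_(j <- i :: s) pos (X j w) -
      prob_pos P (X i) * \prod_(j <- s) pos (X j w))).
    by congr (Ex P); apply/funext => w; rewrite big_nil big_cons /centered; ring.
  rewrite ExB ?ExZ ?Ex_prod_pos /= ?(negPf ni) ?big_cons ?subrr //.
  - exact/bm_prod/bm_posX.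
  - exact/bm_prod/bm_posX.
  - exact/bmZ/bm_prod/bm_posX.
have {ni} [nik ni] : i \notin (k :: s) ++ t /\ i \notin s ++ t.
  by move: ni; rewrite !(mem_cat, inE) !negb_or => /and3P[-> -> ->].
have b u : bounded_meas (fun w => centered i w *
    (\prod_(j <- u) pos (X j w) * \prod_(k <- t) centered k w)).
  apply: bmM (bm_centered i) _.
  by apply: bmM; apply: bm_prod; [exact: bm_posX|exact: bm_centered].
transitivity (Ex P (fun w =>
  centered i w * (\prod_(j <- k :: s) pos (X j w) * \prod_(k <- t) centered k w) -
  prob_pos P (X k) *
  (centered i w * (\prod_(j <- s) pos (X j w) * \prod_(k <- t) centered k w)))).
  by congr (Ex P); apply/funext => w; rewrite !big_cons {2}/centered; ring.
by rewrite ExB ?ExZ ?IH ?mulr0 ?subr0 //; exact: bmZ.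
Qed.

End Independent.

#[export] Hint Resolve bm_posX bm_centered : bounded.

(** * Moments of centered counts *)

Section Independent.
Context {d} {T : measurableType d} {R : realType} (P : probability T R).
Context {I : eqType} (X : I -> {mfun T >-> R}).
Hypothesis indep : mutually_independent P X.
Implicit Types (i j k l : I) (s t : seq I).
Local Notation centered := (centered P X).

Lemma prob_pos_ge0 i : 0 <= prob_pos P (X i).
Proof. exact: fine_ge0. Qed.

Lemma prob_pos_le1 i : prob_pos P (X i) <= 1.
Proof.
rewrite -lee_fin fineK ?fin_num_measure //; last exact/measurable_preimage.
exact/probability_le1/measurable_preimage.
Qed.

Lemma Ex_pos i : Ex P (fun w => pos (X i w)) = prob_pos P (X i).
Proof.
have := Ex_prod_pos P X indep [:: i]; rewrite /= big_cons big_nil mulr1 => <-.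
by congr (Ex P); apply/funext => w; rewrite big_cons big_nil mulr1.
Qed.

Lemma centered_norm_le1 i w : `|centered i w| <= 1.
Proof.
rewrite /centered /pos ler_norml; have := prob_pos_ge0 i; have := prob_pos_le1 i.
by case: (0 < X i w) => /=; lra.
Qed.

Lemma Ex_centeredM i j : Ex P (fun w => centered i w * centered j w) =
  if i == j then prob_pos P (X i) * (1 - prob_pos P (X i)) else 0.
Proof.
case: (eqVneq i j) => [<-|ij]; last first.
  have := @Ex_centered_prod _ _ _ P I X indep i [::] [:: j]; rewrite inE => /(_ ij) <-.
  by congr (Ex P); apply/funext => w; rewrite big_cons !big_nil mul1r mulr1.
set p := prob_pos P (X i).
transitivity (Ex P (fun w => (1 - 2 * p) * pos (X i w) + p ^+ 2)).
  congr (Ex P); apply/funext => w; rewrite /centered -/p /pos.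
  by case: (0 < X i w) => /=; ring.
rewrite ExD ?ExZ ?Ex_cst ?Ex_pos -/p; try by bounded.
ring.
Qed.

(** An index different from the other three makes the expectation vanish ([z], up to a reordering by
    [perm]). Otherwise the indices match in pairs, and the product is at most 1 in absolute
    value. *)
Lemma Ex_centered4_le i j k l :
  Ex P (fun w => centered i w * (centered j w * (centered k w * centered l w))) <=
  ((i == j) && (k == l))%:R + ((i == k) && (j == l))%:R + ((i == l) && (j == k))%:R.
Proof.
have z m n o q : m \notin [:: n; o; q] ->
    Ex P (fun w => centered m w * (centered n w * (centered o w * centered q w))) = 0.
  move=> mi; rewrite -(Ex_centered_prod P X indep m [::] [:: n; o; q] mi).
  by congr (Ex P); apply/funext => w; rewrite !big_cons !big_nil mul1r mulr1.
have perm m n o q : (forall w, centered i w * (centered j w * (centered k w * centered l w)) =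
   centered m w * (centered n w * (centered o w * centered q w))) -> m \notin [:: n; o; q] ->
   Ex P (fun w => centered i w * (centered j w * (centered k w * centered l w))) = 0.
  by move=> /funext -> /z.
have le1 : Ex P (fun w => centered i w * (centered j w * (centered k w * centered l w))) <= 1.
  rewrite -[leRHS](Ex_cst P 1); apply: Ex_le; last first.
    move=> w; apply: le_trans (ler_norm _) _; rewrite !normrM.
    by rewrite !(mulr_ile1, mulr_ge0, centered_norm_le1).
  - exact: bm_cst.
  - by bounded.
case: (eqVneq i j) => [ij|ij]; case: (eqVneq k l) => [kl|kl] /=.
- by apply: le_trans le1 _; rewrite -addrA lerDl addr_ge0.
- rewrite (_ : Ex _ _ = 0) ?addr_ge0 //.
  case: (eqVneq k i) => [ki|ki].
    apply: (@perm l i j k) => [w|]; first by ring.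
    by rewrite !inE -ij ki eq_sym -ki (negPf kl).
  apply: (@perm k i j l) => [w|]; first by ring.
  by rewrite !inE -ij (negPf ki) (negPf kl).
- rewrite (_ : Ex _ _ = 0) ?addr_ge0 //.
  case: (eqVneq i k) => [ik|ik].
    apply: (@perm j i k l) => [w|]; first by ring.
    by rewrite !inE -kl -ik eq_sym (negPf ij).
  by apply: z; rewrite !inE -kl (negPf ij) (negPf ik).
- case: (eqVneq i k) => [ik|ik]; case: (eqVneq j l) => [jl|jl] /=.
  + by apply: le_trans le1 _; rewrite add0r lerDl.
  + rewrite (_ : Ex _ _ = 0) ?addr_ge0 //; apply: (@perm j i k l) => [w|]; first by ring.
    by rewrite !inE -ik eq_sym (negPf ij) (negPf jl).
  + case: (eqVneq i l) => [il|il].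
      by move: kl; rewrite -il => /negPf kl; rewrite (_ : Ex _ _ = 0) ?addr_ge0 //;
        move: ij; rewrite il -jl eqxx.
    by rewrite (_ : Ex _ _ = 0) ?addr_ge0 //; apply: z; rewrite !inE (negPf ij) (negPf ik) (negPf il).
  + case: (eqVneq i l) => [il|il]; last first.
      by rewrite (_ : Ex _ _ = 0) ?addr_ge0 //; apply: z; rewrite !inE (negPf ij) (negPf ik) (negPf il).
    case: (eqVneq j k) => [jk|jk]; first by rewrite !add0r.
    rewrite (_ : Ex _ _ = 0) ?addr_ge0 //; apply: (@perm j i k l) => [w|]; first by ring.
    by rewrite !inE eq_sym (negPf ij) (negPf jk) (negPf jl).
Qed.

Lemma Ex_sum_centered_sqr n (e : 'I_n -> I) : injective e ->
  Ex P (fun w => (\sum_i centered (e i) w) ^+ 2) =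
  \sum_i prob_pos P (X (e i)) * (1 - prob_pos P (X (e i))).
Proof.
move=> inj_e.
transitivity (Ex P (fun w => \sum_i \sum_j centered (e i) w * centered (e j) w)).
  congr (Ex P); apply/funext => w; rewrite expr2 mulr_suml.
  by apply: eq_bigr => i _; rewrite mulr_sumr.
have b i j : bounded_meas (fun w => centered i w * centered j w).
  by bounded.
rewrite Ex_sum; last by move=> i; exact: bm_sum.
apply: eq_bigr => i _; rewrite Ex_sum // (bigD1 i) //= big1 => [|j ji].
  by rewrite Ex_centeredM eqxx addr0.
by rewrite Ex_centeredM (inj_eq inj_e) eq_sym (negPf ji).
Qed.

(** Each of the three ways to pair four indices accounts for n^2 quadruples. *)
Lemma Ex_sum_centered_4_le n (e : 'I_n -> I) : injective e ->
  Ex P (fun w => (\sum_i centered (e i) w) ^+ 4) <= 3 * n%:R ^+ 2.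
Proof.
move=> inj_e.
have b i j k l : bounded_meas (fun w => centered i w * (centered j w * (centered k w * centered l w))).
  by bounded.
pose F (i j k l : 'I_n) w := centered (e i) w * (centered (e j) w * (centered (e k) w * centered (e l) w)).
have -> : Ex P (fun w => (\sum_i centered (e i) w) ^+ 4) =
    \sum_i \sum_j \sum_k \sum_l Ex P (F i j k l).
  transitivity (Ex P (fun w => \sum_i \sum_j \sum_k \sum_l F i j k l w)).
    congr (Ex P); apply/funext => w; rewrite exprS mulr_suml; apply: eq_bigr => i _.
    rewrite exprS mulr_suml mulr_sumr; apply: eq_bigr => j _.
    rewrite expr2 mulr_suml !mulr_sumr; apply: eq_bigr => k _.
    by rewrite !mulr_sumr.
  rewrite Ex_sum; last by move=> i; do 3?[apply: bm_sum => ?]; exact: b.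
  apply: eq_bigr => i _; rewrite Ex_sum; last by move=> ?; do 2?[apply: bm_sum => ?]; exact: b.
  apply: eq_bigr => j _; rewrite Ex_sum; last by move=> ?; do 1?[apply: bm_sum => ?]; exact: b.
  by apply: eq_bigr => k _; rewrite Ex_sum // => ?; exact: b.
have pairs (c : 'I_n) : \sum_(l < n) ((c == l)%:R : R) = 1.
  by rewrite (bigD1 c) //= eqxx big1 ?addr0 // => l; rewrite eq_sym => /negPf ->.
have ones : \sum_(l < n) (1 : R) = n%:R by rewrite sumr_const card_ord.
apply: (@le_trans _ _ (\sum_(i < n) \sum_(j < n) \sum_(k < n) \sum_(l < n)
   ((i == j)%:R * (k == l)%:R + (i == k)%:R * (j == l)%:R + (i == l)%:R * (j == k)%:R))).
  do 4?[apply: ler_sum => ? _]; apply: le_trans (Ex_centered4_le _ _ _ _) _.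
  by rewrite !(inj_eq inj_e) -!natrM !mulnb.
rewrite le_eqVlt; apply/orP; left; apply/eqP.
transitivity (\sum_(i < n) \sum_(j < n) ((i == j)%:R * n%:R + 1 + 1) : R).
  apply: eq_bigr => i _; apply: eq_bigr => j _.
  transitivity (\sum_(k < n) ((i == j)%:R + (i == k)%:R + (j == k)%:R) : R).
    by apply: eq_bigr => k _; rewrite !big_split /= -!mulr_sumr -mulr_suml !pairs; ring.
  by rewrite !big_split /= sumr_const card_ord !pairs mulr_natr.
transitivity (\sum_(i < n) (n%:R + n%:R + n%:R) : R).
  by apply: eq_bigr => i _; rewrite !big_split /= -mulr_suml pairs ones; ring.
by rewrite sumr_const card_ord -mulr_natl; ring.
Qed.

End Independent.

(** * The sign kernel on positive values *)

Definition pos_sg {R : realType} (x y : R) : R := pos x * pos y * Num.sg (y - x).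

Section Kernel.
Context {R : realType}.
Implicit Types x y z : R.

Lemma pos_sgC x y : pos_sg y x = - pos_sg x y.
Proof. by rewrite /pos_sg -[y - x]opprB sgrN; ring. Qed.

Lemma pos_sg_posl x y : pos_sg x y * pos x = pos_sg x y.
Proof. by rewrite /pos_sg /pos; case: (0 < x) => /=; ring. Qed.

Lemma pos_sg_posr x y : pos_sg x y * pos y = pos_sg x y.
Proof. by rewrite /pos_sg /pos; case: (0 < y) => /=; ring. Qed.

(** Two positive values leave only the kernel; if one value is zero, the kernel vanishes and the
    sign is decided by which value is positive. Summed over all pairs this gives A + B. *)
Lemma sg_pos_sg x y : 0 <= x -> 0 <= y -> Num.sg (y - x) = pos_sg x y + (pos y - pos x).
Proof.
rewrite /pos_sg /pos !le0r => /predU1P[->|x0] /predU1P[->|y0];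
  rewrite ?ltxx ?x0 ?y0 /= ?subr0 ?sub0r ?sgrN ?sgr0 ?(gtr0_sg x0) ?(gtr0_sg y0); ring.
Qed.

Lemma sg_pos x : 0 <= x -> Num.sg x = pos x.
Proof. by rewrite le0r /pos => /predU1P[->|x0]; rewrite ?ltxx ?sgr0 // x0 gtr0_sg. Qed.

Lemma pos_sg_sqr x y : x != y -> pos_sg x y ^+ 2 = pos x * pos y.
Proof.
rewrite -subr_eq0 -oppr_eq0 opprB => yx; rewrite /pos_sg /pos !exprMn sqr_sg yx.
by case: (0 < x); case: (0 < y) => /=; ring.
Qed.

(* Of three distinct reals, the middle one contributes -1 and the other two
   contribute 1 each. *)
Lemma pos_sg_triple x y z : x != y -> y != z -> x != z ->
  pos_sg x y * pos_sg x z + pos_sg y x * pos_sg y z + pos_sg z x * pos_sg z y =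
  pos x * pos y * pos z.
Proof.
move=> xy yz xz; rewrite /pos_sg /pos.
case: (0 < x); case: (0 < y); case: (0 < z); rewrite /= ?(mul1r, mul0r, mulr0, addr0) //.
have g (u v : R) : u < v -> Num.sg (v - u) = 1 by move=> uv; rewrite gtr0_sg // subr_gt0.
have l (u v : R) : u < v -> Num.sg (u - v) = -1 by move=> uv; rewrite ltr0_sg // subr_lt0.
have [xy'|xy'|E] := ltgtP x y; last by rewrite E eqxx in xy.
- have [yz'|yz'|E] := ltgtP y z; last by rewrite E eqxx in yz.
  + have xz' := lt_trans xy' yz'; rewrite !(g _ _ xy', l _ _ xy', g _ _ yz', l _ _ yz', g _ _ xz', l _ _ xz'); ring.
  + have [xz'|xz'|E] := ltgtP x z; last by rewrite E eqxx in xz.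
      rewrite !(g _ _ xy', l _ _ xy', g _ _ yz', l _ _ yz', g _ _ xz', l _ _ xz'); ring.
    rewrite !(g _ _ xy', l _ _ xy', g _ _ yz', l _ _ yz', g _ _ xz', l _ _ xz'); ring.
- have [yz'|yz'|E] := ltgtP y z; last by rewrite E eqxx in yz.
  + have [xz'|xz'|E] := ltgtP x z; last by rewrite E eqxx in xz.
      rewrite !(g _ _ xy', l _ _ xy', g _ _ yz', l _ _ yz', g _ _ xz', l _ _ xz'); ring.
    rewrite !(g _ _ xy', l _ _ xy', g _ _ yz', l _ _ yz', g _ _ xz', l _ _ xz'); ring.
  + have xz' := lt_trans yz' xy'; rewrite !(g _ _ xy', l _ _ xy', g _ _ yz', l _ _ yz', g _ _ xz', l _ _ xz'); ring.
Qed.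

Lemma pos_sgE x y : x != y -> pos_sg x y = pos x * pos y - 2 * (pos x * pos y * (y < x)%R%:R).
Proof.
rewrite /pos_sg; case: (ltgtP x y) => //= xy _.
  by rewrite gtr0_sg ?subr_gt0 //; ring.
by rewrite ltr0_sg ?subr_lt0 //; ring.
Qed.

Lemma bm_sg : bounded_meas (fun x : R => Num.sg x).
Proof.
have -> : (fun x : R => Num.sg x) = (fun x => pos x - pos (- x)).
  apply/funext => x; rewrite /pos oppr_gt0; case: (ltgtP x 0) => [x0|x0|->] /=.
  - by rewrite ltr0_sg // sub0r.
  - by rewrite gtr0_sg // subr0.
  - by rewrite sgr0 subrr.
apply: bmB; first exact: bm_pos.
apply: (bm_comp pos (fun x => - x)) bm_pos; exact: (measurable_funN (@measurable_id _ R setT)).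
Qed.

Lemma bm_pos_sg {d} {T : measurableType d} (f g : T -> R) :
  measurable_fun setT f -> measurable_fun setT g ->
  bounded_meas (fun w => pos_sg (f w) (g w)).
Proof.
move=> mf mg; rewrite /pos_sg; apply: bmM.
  by apply: bmM; apply: bm_comp bm_pos.
by apply: (bm_comp (fun x => Num.sg x)) bm_sg; exact: measurable_funB.
Qed.

End Kernel.

(** * Absence of positive ties, and the conditional law of positive values *)

Section Pairs.
Context {d} {T : measurableType d} {R : realType} (P : probability T R).
Context {I : eqType} (X : I -> {mfun T >-> R}).
Hypothesis indep : mutually_independent P X.
Implicit Types (i j k l : I) (s t : seq I).

Lemma measurable_pair_ltr : measurable [set z : R * R | z.2 < z.1].
Proof.
have mt : measurable [set true] by [].
rewrite -[X in measurable X]setTI.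
have := measurable_fun_ltr (@measurable_snd _ _ R R) (@measurable_fst _ _ R R).
by move=> /(_ measurableT [set true] mt); congr measurable; apply/seteqP; split.
Qed.

Lemma measurable_pair_eqr : measurable [set z : R * R | z.1 = z.2].
Proof.
have mt : measurable [set true] by [].
rewrite -[X in measurable X]setTI.
have := measurable_fun_eqr (@measurable_fst _ _ R R) (@measurable_snd _ _ R R).
move=> /(_ measurableT [set true] mt); congr measurable; apply/seteqP; split => z [] //= _ /eqP //.
Qed.

(** Under the product law, the diagonal above x > 0 has sections inside singletons {x}, which are
    null since [X j] has no positive atom. The restriction to x > 0 is essential, as ties at zero do
    occur. *)
Lemma ae_pos_neq i j : i != j -> zero_inflated P (X j) ->
  {ae P, forall w, 0 < X i w -> X i w != X j w}.
Proof.
move=> ij [_ atomless].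
pose D := [set z : R * R | z.1 = z.2] `&` ([set` `]0, +oo[] `*` setT).
have mD : measurable D.
  apply: measurableI measurable_pair_eqr _; apply: measurableX => //.
exists (pair_fun (X i) (X j) @^-1` D); split.
- by rewrite -[X in measurable X]setTI; exact: measurable_funPT.
- have := @product_measure_unique _ _ _ _ R (distribution P (X i)) (distribution P (X j))
    (pushforward P (pair_fun (X i) (X j))) _ D mD.
  move=> prodE; rewrite -[LHS]/(pushforward P (pair_fun (X i) (X j)) D) -prodE; last first.
    by move=> A B mA mB; exact: indep2.
  rewrite /product_measure1 integral0_eq // => x _.
  apply/eqP; rewrite -measure_le0; have [x0|x0] := ltP 0 x.
    rewrite -(atomless x x0); apply: le_measure; rewrite ?inE //.
    - exact: measurable_xsection.
    - by move=> y /xsectionP[/= ->].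
  rewrite -(measure0 (distribution P (X j))); apply: le_measure; rewrite ?inE //.
    exact: measurable_xsection.
  by move=> y /xsectionP[/= _ []]; rewrite in_itv /= andbT ltNge x0.
- move=> w /= /not_implyP[x0 /negP]; rewrite negbK => /eqP E; split => //=; split => //=.
  by rewrite in_itv /= x0.
Qed.

(** The joint law restricted to the positive quadrant and divided by both probabilities agrees with
    the conditional product law on rectangles, hence everywhere. *)
Lemma pos_law_prod i j : i != j -> 0 < prob_pos P (X i) -> 0 < prob_pos P (X j) ->
  forall E, measurable E ->
  fine ((pos_law P (X i) \x pos_law P (X j))%E E) * (prob_pos P (X i) * prob_pos P (X j)) =
  fine (P (pair_fun (X i) (X j) @^-1` (E `&` ([set` `]0, +oo[] `*` [set` `]0, +oo[])))).
Proof.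
move=> ij p_i p_j E mE.
have mpos : measurable ([set` `]0, +oo[] `*` [set` `]0, +oo[] : set (R * R)).
  by apply: measurableX.
pose m0 : {measure set (R * R) -> \bar R} := mrestr (pushforward P (pair_fun (X i) (X j))) mpos.
pose m := m0 (measurable_funPT _).
pose pR : set R := [set` `]0, +oo[].
have c0 : 0 <= (prob_pos P (X i) * prob_pos P (X j))^-1 by rewrite invr_ge0 ltW ?mulr_gt0.
pose c : {nonneg R} := NngNum c0.
have posE k A : 0 < prob_pos P (X k) -> measurable A ->
    pos_law P (X k) A = (P (X k @^-1` (A `&` pR)) * (prob_pos P (X k))^-1%:E)%E.
  move=> pk mA; rewrite /pos_law /= /mnormalize /= /mrestr /= setTI /distribution /pushforward.
  (* [mnormalize] falls back to the Dirac mass when the total mass is 0 or infinite; [fine] sends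
     both to 0, against [pk]. *)
  rewrite -/(prob_pos P (X k)) ifF //; apply/negbTE; rewrite negb_or; apply/andP; split.
    by apply: contraTneq pk => E0; rewrite /prob_pos E0 ltxx.
  by apply: contraTneq pk => E0; rewrite /prob_pos E0 ltxx.
have <- : mscale c m E = (pos_law P (X i) \x pos_law P (X j))%E E.
  symmetry; apply: product_measure_unique => // A B mA mB.
  rewrite -[LHS]/(((prob_pos P (X i) * prob_pos P (X j))^-1)%:E *
    P (pair_fun (X i) (X j) @^-1` ((A `*` B) `&` (pR `*` pR))))%E -setXI.
  rewrite (_ : _ @^-1` _ = X i @^-1` (A `&` pR) `&` X j @^-1` (B `&` pR)) //.
  have mpR C : measurable C -> measurable (C `&` pR) by move=> mC; apply: measurableI => //; exact: measurable_itv.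
  rewrite (indep2 P X indep _ _ _ _ ij (mpR _ mA) (mpR _ mB)).
  rewrite invfM EFinM muleACA [X in (X * _)%E]muleC [X in (_ * X)%E]muleC.
  by rewrite -(posE i A p_i mA) -(posE j B p_j mB).
rewrite -[mscale c m E]/(((prob_pos P (X i) * prob_pos P (X j))^-1)%:E *
    P (pair_fun (X i) (X j) @^-1` (E `&` (pR `*` pR))))%E.
rewrite fineM ?fin_num_measure //=; last first.
  by rewrite -[X in measurable X]setTI; apply: measurable_funPT => //; exact: measurableI.
by rewrite mulrC mulrA mulfV ?mul1r ?gt_eqF ?mulr_gt0.
Qed.

(** Almost surely there is no positive tie, so the kernel is the indicator of two positive values
    minus twice the indicator that moreover [X i] is the larger. The minus sign reflects the
    descending ranks. *)
Lemma Ex_pos_sg i j : i != j -> zero_inflated P (X j) ->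
  0 < prob_pos P (X i) -> 0 < prob_pos P (X j) ->
  Ex P (fun w => pos_sg (X i w) (X j w)) =
  - (2 * pos_shift P (X i) (X j) * (prob_pos P (X i) * prob_pos P (X j))).
Proof.
move=> ij zj p_i p_j.
rewrite /pos_shift mulrBr mulfV // mulrBl mul1r -mulrA (pos_law_prod _ _ ij p_i p_j) //; last first.
  exact: measurable_pair_ltr.
set D := _ `&` _.
have mD : measurable (pair_fun (X i) (X j) @^-1` D).
  rewrite -[X in measurable X]setTI; apply: measurable_funPT => //.
  by apply: measurableI measurable_pair_ltr _; exact: measurableX.
have bD : bounded_meas (\1_(pair_fun (X i) (X j) @^-1` D) : T -> R).
  split; first exact: measurable_indic.
  by exists 1 => w; rewrite indicE; case: (_ \in _); rewrite ?normr1 ?normr0.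
have -> : fine (P (pair_fun (X i) (X j) @^-1` D)) =
    Ex P (\1_(pair_fun (X i) (X j) @^-1` D)) by rewrite /Ex expectation_indic.
have := Ex_prod_pos P X indep [:: i; j]; rewrite /= inE (negPf ij) /= !big_cons big_nil mulr1 => <-.
have bij : bounded_meas (fun w => \prod_(k <- [:: i; j]) pos (X k w)).
  by apply: bm_prod => k; exact: bm_posX.
rewrite -(ExZ P 2 bD) opprB -ExB //; last exact: bmZ.
apply: Ex_ae; first exact: bm_pos_sg.
  by apply: bmB => //; exact: bmZ.
have aeN := ae_pos_neq _ _ ij zj; apply: filterS aeN => w.
have -> : \1_(pair_fun (X i) (X j) @^-1` D) w = pos (X i w) * pos (X j w) * (X j w < X i w)%R%:R :> R.
  rewrite indicE /pos -!natrM !mulnb; congr (_%:R); congr nat_of_bool.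
  apply/idP/idP; first by rewrite inE /= => -[/= -> []]; rewrite !in_itv /= !andbT => -> ->.
  by move=> /andP[/andP[xi xj] ji]; rewrite inE; split => //=; split; rewrite /= in_itv /= ?xi ?xj.
rewrite !big_cons big_nil mulr1; have [x0|x0] := ltP 0 (X i w).
  by move=> /(_ isT) /pos_sgE.
by rewrite /pos_sg /pos ltNge x0 /= => _; ring.
Qed.

End Pairs.

(** * Second moments under the null hypothesis *)

Lemma sum_delta {R : realType} n (c : 'I_n) : \sum_(l < n) ((c == l)%:R : R) = 1.
Proof. by rewrite (bigD1 c) //= eqxx big1 ?addr0 // => l; rewrite eq_sym => /negPf ->. Qed.

Lemma sum_cst {R : realType} n (x : R) : \sum_(l < n) x = n%:R * x.
Proof. by rewrite sumr_const card_ord mulr_natl. Qed.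

Section Sample.
Context {d} {T : measurableType d} {R : realType} (P : probability T R).
Context {I : eqType} (X : I -> {mfun T >-> R}).

Lemma bm_pos_sgX (i j : I) : bounded_meas (fun w => pos_sg (X i w) (X j w)).
Proof. by apply: bm_pos_sg; exact: measurable_funPT. Qed.

Definition pair_sum n1 n0 (a : 'I_n1 -> I) (c : 'I_n0 -> I) (w : T) : R :=
  \sum_i \sum_j pos_sg (X (a i) w) (X (c j) w).

Definition count_diff n1 n0 (a : 'I_n1 -> I) (c : 'I_n0 -> I) (w : T) : R :=
  n1%:R * (\sum_j pos (X (c j) w)) - n0%:R * (\sum_i pos (X (a i) w)).

Lemma bm_pair_sum n1 n0 (a : 'I_n1 -> I) (c : 'I_n0 -> I) : bounded_meas (pair_sum _ _ a c).
Proof. by apply: bm_sum => i; apply: bm_sum => j; exact: bm_pos_sgX. Qed.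

Lemma bm_count_diff n1 n0 (a : 'I_n1 -> I) (c : 'I_n0 -> I) : bounded_meas (count_diff _ _ a c).
Proof. by rewrite /count_diff; bounded. Qed.

Hypothesis indep : mutually_independent P X.
Hypothesis fresh : forall s : seq I, exists i, i \notin s.
Hypothesis same : forall i j, same_law P X i j.
Hypothesis zi : forall i, zero_inflated P (X i).
Variable p : R.
Hypothesis pE : forall i, prob_pos P (X i) = p.

(** [exchangeable] needs four distinct indices; [fresh] supplies the dummy fourth one. *)
Lemma exchangeable3 (h : R -> R -> R -> R) i j k i' j' k' :
  uniq [:: i; j; k] -> uniq [:: i'; j'; k'] ->
  bounded_meas (fun z : R * (R * (R * R)) => h z.1 z.2.1 z.2.2.1) ->
  Ex P (fun w => h (X i w) (X j w) (X k w)) = Ex P (fun w => h (X i' w) (X j' w) (X k' w)).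
Proof.
move=> u u'; have [l lN] := fresh [:: i; j; k]; have [l' lN'] := fresh [:: i'; j'; k'].
apply: (@exchangeable _ _ _ P _ X indep (fun x y z _ => h x y z) _ _ _ l _ _ _ l') => //; try exact: same.
- by rewrite -[X in uniq X]/(rcons [:: i; j; k] l) rcons_uniq lN.
- by rewrite -[X in uniq X]/(rcons [:: i'; j'; k'] l') rcons_uniq lN'.
Qed.

Let Z1 := fun z : R * (R * (R * R)) => z.1.
Let Z2 := fun z : R * (R * (R * R)) => z.2.1.
Let Z3 := fun z : R * (R * (R * R)) => z.2.2.1.
Let Z4 := fun z : R * (R * (R * R)) => z.2.2.2.

Let mZ1 : measurable_fun setT Z1.
Proof. exact: measurable_fst. Qed.
Let mZ2 : measurable_fun setT Z2.
Proof. exact: (measurableT_comp measurable_fst measurable_snd). Qed.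
Let mZ3 : measurable_fun setT Z3.
Proof. exact: (measurableT_comp measurable_fst (measurableT_comp measurable_snd measurable_snd)). Qed.
Let mZ4 : measurable_fun setT Z4.
Proof. exact: (measurableT_comp measurable_snd (measurableT_comp measurable_snd measurable_snd)). Qed.

(** Swapping [i] and [j] flips the sign of the kernel and leaves a third variable alone. If [k] is
    [i] or [j], the kernel absorbs the extra indicator, and the same swap applies with a constant
    third factor. *)
Lemma Ex_pos_sg_pos i j k : i != j ->
  Ex P (fun w => pos_sg (X i w) (X j w) * pos (X k w)) = 0.
Proof.
move=> ij.
have E0 g k' : k' \notin [:: i; j] -> bounded_meas g ->
    Ex P (fun w => pos_sg (X i w) (X j w) * g (X k' w)) = 0.
  rewrite !inE negb_or => /andP[k'i k'j] bg.
  suff E : Ex P (fun w => pos_sg (X i w) (X j w) * g (X k' w)) =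
           - Ex P (fun w => pos_sg (X i w) (X j w) * g (X k' w)) by lra.
  have bij : bounded_meas (fun w => pos_sg (X i w) (X j w) * g (X k' w)).
    apply: bmM; first exact: bm_pos_sgX.
    by apply: bm_comp bg; exact: measurable_funPT.
  rewrite {1}(exchangeable3 (fun x y z => pos_sg x y * g z) i j k' j i k').
  - by rewrite -ExN //; congr (Ex P); apply/funext => w; rewrite pos_sgC mulNr.
  - by rewrite /= !inE negb_or ij ![_ == k']eq_sym k'i k'j.
  - by rewrite /= !inE negb_or ![_ == k']eq_sym k'i k'j eq_sym ij.
  - apply: bmM; first exact: (bm_pos_sg Z1 Z2).
    exact: (bm_comp g Z3).
have [k' k'N] := fresh [:: i; j].
have := E0 (fun=> 1) k' k'N (bm_cst 1); under eq_fun do rewrite mulr1.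
case: (boolP (k \in [:: i; j])) => [|kN _]; last exact: E0 bm_pos.
rewrite !inE => /orP[] /eqP -> <-; congr (Ex P); apply/funext => w.
  by rewrite pos_sg_posl.
by rewrite pos_sg_posr.
Qed.

Lemma Ex_pos_sg0 i j : i != j -> Ex P (fun w => pos_sg (X i w) (X j w)) = 0.
Proof.
move=> ij; rewrite -(Ex_pos_sg_pos i j i ij); congr (Ex P); apply/funext => w.
by rewrite pos_sg_posl.
Qed.

Lemma Ex_pos_sgM_disjoint i j k l : uniq [:: i; j; k; l] ->
  Ex P (fun w => pos_sg (X i w) (X j w) * pos_sg (X k w) (X l w)) = 0.
Proof.
move=> u; set E := Ex P _; suff : E = - E by lra.
rewrite {1}/E (exchangeable P X indep (fun x y z t => pos_sg x y * pos_sg z t) i j k l j i k l) //; try exact: same.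
- rewrite -ExN; last by apply: bmM; exact: bm_pos_sgX.
  by congr (Ex P); apply/funext => w; rewrite pos_sgC mulNr.
- move: u; rewrite /= !inE !negb_or => /and3P[/and3P[ij ik il] /andP[jk jl] kl].
  by rewrite eq_sym ij ik il jk jl kl.
- by apply: bmM; [exact: (bm_pos_sg Z1 Z2)|exact: (bm_pos_sg Z3 Z4)].
Qed.

(** The three choices of the shared index have equal expectations, and by [pos_sg_triple] their
    products add up almost surely to the indicator that all three values are positive, of mean
    p^3. *)
Lemma Ex_pos_sgM i j k : uniq [:: i; j; k] ->
  Ex P (fun w => pos_sg (X i w) (X j w) * pos_sg (X i w) (X k w)) = p ^+ 3 / 3.
Proof.
move=> u; set E := Ex P _.
have [ij ik jk] : [/\ i != j, i != k & j != k].
  by move: u; rewrite /= !inE negb_or => /and3P[/andP[]].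
pose h x y z : R := pos_sg x y * pos_sg x z.
have bh : bounded_meas (fun z : R * (R * (R * R)) => h z.1 z.2.1 z.2.2.1).
  by apply: bmM; [exact: (bm_pos_sg Z1 Z2)|exact: (bm_pos_sg Z1 Z3)].
have bX i' j' k' : bounded_meas (fun w => h (X i' w) (X j' w) (X k' w)).
  by apply: bmM; exact: bm_pos_sgX.
have E2 : E = Ex P (fun w => h (X j w) (X i w) (X k w)).
  by apply: (exchangeable3 h) => //; rewrite /= !inE negb_or eq_sym ij jk ik.
have E3 : E = Ex P (fun w => h (X k w) (X i w) (X j w)).
  by apply: (exchangeable3 h) => //; rewrite /= !inE negb_or ![k == _]eq_sym ij jk ik.
suff : E + E + E = p ^+ 3 by move=> <-; field.
have -> : E + E + E = Ex P (fun w => h (X i w) (X j w) (X k w)) +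
    Ex P (fun w => h (X j w) (X i w) (X k w)) + Ex P (fun w => h (X k w) (X i w) (X j w)).
  by rewrite -E2 -E3.
rewrite -!ExD //; last exact: bmD.
have := Ex_prod_pos P X indep [:: i; j; k].
rewrite undup_id // !big_cons !big_nil !pE mulr1 => Eppp; rewrite exprS expr2 -Eppp.
apply: Ex_ae; [by do 2?apply: bmD|by apply: bm_prod => ?; exact: bm_posX|].
have n1 := ae_pos_neq P X indep _ _ ij (zi j).
have n2 := ae_pos_neq P X indep _ _ ik (zi k).
have n3 := ae_pos_neq P X indep _ _ jk (zi k).
apply: filterS3 n1 n2 n3 => w n1 n2 n3; rewrite !big_cons big_nil mulr1 mulrA.
have [xi|xi] := ltP 0 (X i w); last first.
  by rewrite /h /pos_sg /pos ltNge xi /=; ring.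
have [xj|xj] := ltP 0 (X j w); last first.
  by rewrite /h /pos_sg /pos [0 < X j w]ltNge xj /=; ring.
by rewrite -pos_sg_triple ?n1 ?n2 ?n3.
Qed.

Lemma Ex_pos_sg_sqr i j : i != j -> Ex P (fun w => pos_sg (X i w) (X j w) ^+ 2) = p ^+ 2.
Proof.
move=> ij; have := Ex_prod_pos P X indep [:: i; j].
rewrite undup_id /= ?inE ?ij // !big_cons !big_nil !pE mulr1 expr2 => <-.
apply: Ex_ae; [exact/bmX/bm_pos_sgX|by apply: bm_prod => ?; exact: bm_posX|].
have n1 := ae_pos_neq P X indep _ _ ij (zi j).
apply: filterS n1 => w n1; rewrite !big_cons big_nil mulr1.
have [xi|xi] := ltP 0 (X i w); first by rewrite pos_sg_sqr ?n1.
by rewrite /pos_sg /pos ltNge xi /=; ring.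
Qed.

Context {n1 n0 : nat} (a : 'I_n1 -> I) (c : 'I_n0 -> I).
Hypothesis inj_a : injective a.
Hypothesis inj_c : injective c.
Hypothesis disj : forall i j, a i != c j.

Lemma Ex_pair_sum0 : Ex P (pair_sum _ _ a c) = 0.
Proof.
rewrite Ex_sum; last by move=> i; apply: bm_sum => j; exact: bm_pos_sgX.
rewrite big1 // => i _; rewrite Ex_sum; last by move=> j; exact: bm_pos_sgX.
by rewrite big1 // => j _; exact: Ex_pos_sg0.
Qed.

Lemma Ex_count_diff0 : Ex P (count_diff _ _ a c) = 0.
Proof.
rewrite ExB ?ExZ ?Ex_sum; try by bounded.
under eq_bigr do rewrite (Ex_pos P X indep) pE.
under [X in _ - _ * X]eq_bigr do rewrite (Ex_pos P X indep) pE.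
by rewrite !sum_cst; ring.
Qed.

(** A pair of index pairs contributes p^2 if they coincide, p^3 / 3 if they share exactly one index
    and 0 if they are disjoint. A given pair shares exactly one index with n_0 + n_1 - 2 others. *)
Lemma Ex_pair_sum_sqr : Ex P (fun w => pair_sum _ _ a c w ^+ 2) =
  n0%:R * n1%:R * (p ^+ 2 + (n0%:R + n1%:R - 2) * (p ^+ 3 / 3)).
Proof.
pose s i j w : R := pos_sg (X (a i) w) (X (c j) w).
have bs i j : bounded_meas (s i j) by exact: bm_pos_sgX.
transitivity (Ex P (fun w => \sum_i \sum_j \sum_i' \sum_j' s i j w * s i' j' w)).
  congr (Ex P); apply/funext => w; rewrite expr2 mulr_suml; apply: eq_bigr => i _.
  rewrite mulr_suml; apply: eq_bigr => j _; rewrite mulr_sumr.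
  by apply: eq_bigr => i' _; rewrite mulr_sumr.
transitivity (\sum_(i < n1) \sum_(j < n0)
   (p ^+ 2 + (n0%:R + n1%:R - 2) * (p ^+ 3 / 3))); last first.
  by rewrite !sum_cst; ring.
rewrite Ex_sum => [|i]; last by bounded.
apply: eq_bigr => i _; rewrite Ex_sum => [|j]; last by bounded.
apply: eq_bigr => j _; rewrite Ex_sum => [|i']; last by bounded.
(* All cases in one formula: on the diagonal both single deltas fire, so their two copies of p^3 / 3
   are taken back. *)
transitivity (\sum_(i' < n1) \sum_(j' < n0) ((i == i')%:R * (j == j')%:R * (p ^+ 2 - 2 * (p ^+ 3 / 3))
   + (i == i')%:R * (p ^+ 3 / 3) + (j == j')%:R * (p ^+ 3 / 3)) : R); last first.
  transitivity (\sum_(i' < n1) ((i == i')%:R * (p ^+ 2 - 2 * (p ^+ 3 / 3) + n0%:R * (p ^+ 3 / 3)) + p ^+ 3 / 3)).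
    apply: eq_bigr => i' _; rewrite !big_split /= -!mulr_suml -mulr_sumr sum_delta.
    by rewrite sum_cst; ring.
  by rewrite big_split /= -mulr_suml sum_delta sum_cst; ring.
apply: eq_bigr => i' _; rewrite Ex_sum => [|j']; last by bounded.
apply: eq_bigr => j' _; rewrite /s.
case: (eqVneq i i') => [<-|ii']; case: (eqVneq j j') => [<-|jj'] /=.
- by rewrite -[LHS]/(Ex P (fun w => pos_sg (X (a i) w) (X (c j) w) ^+ 2)) Ex_pos_sg_sqr //; ring.
- rewrite Ex_pos_sgM; first by ring.
  by rewrite /= !inE negb_or !disj (inj_eq inj_c) jj'.
(* Two sign changes bring the shared index to the first argument, as [Ex_pos_sgM] requires. *)
- transitivity (Ex P (fun w => pos_sg (X (c j) w) (X (a i) w) * pos_sg (X (c j) w) (X (a i') w))).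
    by congr (Ex P); apply/funext => w; rewrite !(pos_sgC (X (c j) w)) mulrNN.
  rewrite Ex_pos_sgM; first by ring.
  by rewrite /= !inE negb_or ![c j == _]eq_sym !disj (inj_eq inj_a) ii'.
- rewrite Ex_pos_sgM_disjoint; first by ring.
  by rewrite /= !inE !negb_or !disj (inj_eq inj_a) ii' (inj_eq inj_c) jj' eq_sym disj.
Qed.

Lemma Ex_pair_sum_count_diff : Ex P (fun w => pair_sum _ _ a c w * count_diff _ _ a c w) = 0.
Proof.
pose s i j w : R := pos_sg (X (a i) w) (X (c j) w).
have bs i j : bounded_meas (s i j) by exact: bm_pos_sgX.
transitivity (Ex P (fun w => \sum_i \sum_j (n1%:R * (\sum_k s i j w * pos (X (c k) w))
   - n0%:R * (\sum_k s i j w * pos (X (a k) w))))).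
  congr (Ex P); apply/funext => w; rewrite mulr_suml; apply: eq_bigr => i _.
  rewrite mulr_suml; apply: eq_bigr => j _; rewrite -!mulr_sumr /count_diff /s; ring.
rewrite Ex_sum => [|i]; last by bounded.
rewrite big1 // => i _; rewrite Ex_sum => [|j]; last by bounded.
rewrite big1 // => j _; rewrite ExB ?ExZ ?Ex_sum; try by [bounded|move=> ?; bounded].
by rewrite !big1 ?mulr0 ?subr0 // => k _; exact: Ex_pos_sg_pos.
Qed.

Lemma Ex_count_diff_sqr : Ex P (fun w => count_diff _ _ a c w ^+ 2) =
  n0%:R * n1%:R * (n0%:R + n1%:R) * (p * (1 - p)).
Proof.
(* Centering leaves [count_diff] unchanged, because the two subtracted terms n_1 n_0 p and n_0 n_1 p
   cancel. *)
pose S1 w := \sum_i centered P X (a i) w; pose S0 w := \sum_j centered P X (c j) w.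
have bS1 : bounded_meas S1 by rewrite /S1; bounded.
have bS0 : bounded_meas S0 by rewrite /S0; bounded.
transitivity (Ex P (fun w => n1%:R ^+ 2 * S0 w ^+ 2 + n0%:R ^+ 2 * S1 w ^+ 2 -
   2 * n0%:R * n1%:R * (S1 w * S0 w))).
  congr (Ex P); apply/funext => w; rewrite /S1 /S0 /count_diff /centered.
  under [X in _ = _ * X ^+ 2 + _ - _]eq_bigr do rewrite pE.
  under [X in _ = _ + _ * X ^+ 2 - _]eq_bigr do rewrite pE.
  under [X in _ = _ - _ * (X * _)]eq_bigr do rewrite pE.
  under [X in _ = _ - _ * (_ * X)]eq_bigr do rewrite pE.
  by rewrite !sumrB !sum_cst; ring.
rewrite ExB ?ExD ?ExZ; try by bounded.
have -> : Ex P (fun w => S1 w * S0 w) = 0.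
  transitivity (Ex P (fun w => \sum_i \sum_j centered P X (a i) w * centered P X (c j) w)).
    congr (Ex P); apply/funext => w; rewrite mulr_suml.
    by apply: eq_bigr => i _; rewrite mulr_sumr.
  rewrite Ex_sum => [|i]; last by bounded.
  rewrite big1 // => i _; rewrite Ex_sum => [|j]; last by bounded.
  by rewrite big1 // => j _; rewrite (Ex_centeredM P X indep) (negPf (disj i j)).
rewrite !(Ex_sum_centered_sqr P X indep) //.
under eq_bigr do rewrite pE; under [X in _ + _ * X]eq_bigr do rewrite pE.
by rewrite !sum_cst; ring.
Qed.

Lemma Ex_combination_sqr (b : R) :
  Ex P (fun w => (pair_sum _ _ a c w + b * count_diff _ _ a c w) ^+ 2) =
  n0%:R * n1%:R * (p ^+ 2 + (n0%:R + n1%:R - 2) * (p ^+ 3 / 3) +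
    b ^+ 2 * (n0%:R + n1%:R) * (p * (1 - p))).
Proof.
have bA := bm_pair_sum _ _ a c; have bB := bm_count_diff _ _ a c.
transitivity (Ex P (fun w => pair_sum _ _ a c w ^+ 2 +
   2 * b * (pair_sum _ _ a c w * count_diff _ _ a c w) + b ^+ 2 * count_diff _ _ a c w ^+ 2)).
  by congr (Ex P); apply/funext => w; ring.
rewrite !ExD ?ExZ; try by bounded.
rewrite Ex_pair_sum_sqr Ex_pair_sum_count_diff Ex_count_diff_sqr; ring.
Qed.

End Sample.

(** * The statistics as functions of the samples *)

Lemma big_mkseq {R : realType} {S : Type} (f : nat -> S) n (F : S -> R) :
  \sum_(x <- mkseq f n) F x = \sum_(i < n) F (f i).
Proof. by rewrite /mkseq big_map -[RHS](big_mkord xpredT (fun i => F (f i))) /index_iota subn0. Qed.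

Lemma natr_count {R : realType} {S : Type} (a : pred S) (s : seq S) :
  (count a s)%:R = \sum_(x <- s) (a x)%:R :> R.
Proof. by rewrite -sum1_count natr_sum big_mkcond; apply: eq_bigr => x _; case: (a x). Qed.

(** A function of integer-valued variables is measurable whatever [G] is, since every preimage is a
    countable union of fibers. This handles the arbitrary rounding rule. *)
Lemma measurable_nat3 {d} {T : measurableType d} {R : realType} (f g h : T -> nat)
    (G : nat -> nat -> nat -> R) :
  measurable_fun setT (fun w => (f w)%:R : R) ->
  measurable_fun setT (fun w => (g w)%:R : R) ->
  measurable_fun setT (fun w => (h w)%:R : R) ->
  measurable_fun setT (fun w => G (f w) (g w) (h w)).
Proof.
have fiber (u : T -> nat) n : measurable_fun setT (fun w => (u w)%:R : R) ->
    measurable [set w | u w = n].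
  move=> mu; have := mu measurableT _ (measurable_set1 (n%:R : R)).
  rewrite setTI; congr measurable; apply/seteqP; split => w /=; last by move=> ->.
  by move/eqP; rewrite eqr_nat => /eqP.
move=> mf mg mh _ B mB; rewrite setTI.
rewrite (_ : _ @^-1` B = \bigcup_i \bigcup_j \bigcup_k
  (([set w | f w = i] `&` [set w | g w = j]) `&` ([set w | h w = k] `&` [set w | B (G i j k)]))).
  apply: bigcupT_measurable => i; apply: bigcupT_measurable => j; apply: bigcupT_measurable => k.
  apply: measurableI; first by apply: measurableI; exact: fiber.
  apply: measurableI; first exact: fiber.
  have [BG|BG] := pselect (B (G i j k)).
    by rewrite (_ : [set _ | _] = setT) //; apply/seteqP; split.
  by rewrite (_ : [set _ | _] = set0) //; apply/seteqP; split.
apply/seteqP; split => w /=.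
  by move=> Bw; exists (f w) => //; exists (g w) => //; exists (h w).
by move=> [i _ [j _ [k _ [[/= <- <-] [/= <-]]]]].
Qed.

Section Samples.
Context {d} {T : measurableType d} {R : realType} (P : probability T R).
Context (Y : bool -> nat -> {mfun T >-> R}) (rnd : R -> nat) (n1 n0 : nat).

Definition obs (ki : bool * nat) : {mfun T >-> R} := Y ki.1 ki.2.
Definition idx (k : bool) (n : nat) (i : 'I_n) : bool * nat := (k, nat_of_ord i).
Definition A_sum : T -> R := pair_sum obs _ _ (idx true n1) (idx false n0).
Definition B_sum : T -> R := count_diff obs _ _ (idx true n1) (idx false n0).
Definition npos (k : bool) (n : nat) (w : T) : R := \sum_(i < n) pos (Y k i w).
Definition max_prop (w : T) : R := Num.max (npos false n0 w / n0%:R) (npos true n1 w / n1%:R).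

Lemma bm_posY k i : bounded_meas (fun w => pos (Y k i w)).
Proof. exact: (bm_posX obs (k, i)). Qed.

Lemma bm_npos k n : bounded_meas (npos k n).
Proof. by apply: bm_sum => i; exact: bm_posY. Qed.

Lemma npos_bounds k n w : 0 <= npos k n w <= n%:R.
Proof.
rewrite sumr_ge0 => [|i _]; last exact: ler0n.
rewrite -[leRHS]mulr1 -sum_cst; apply: ler_sum => i _.
by rewrite /pos; case: (0 < _).
Qed.

Lemma pos_proportionE k n w :
  pos_proportion (mkseq (fun i => Y k i w) n) = npos k n w / n%:R.
Proof. by rewrite /pos_proportion size_mkseq natr_count big_mkseq. Qed.

Lemma prop_bounds k n w : 0 <= npos k n w / n%:R <= 1.
Proof.
have /andP[N0 Nn] := npos_bounds k n w; rewrite divr_ge0 //=.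
by case: n N0 Nn => [|n] N0 Nn; rewrite ?invr0 ?mulr0 // ler_pdivrMr ?mul1r ?ltr0n.
Qed.

Lemma max_prop_bounds w : 0 <= max_prop w <= 1.
Proof.
rewrite /max_prop; have /andP[a b] := prop_bounds false n0 w.
by have /andP[a' b'] := prop_bounds true n1 w; rewrite le_max ge_max a b b'.
Qed.

Lemma npos_le_max_prop k w : let n := if k then n1 else n0 in
  npos k n w <= n%:R * max_prop w.
Proof.
have g k' n : npos k' n w <= n%:R * (npos k' n w / n%:R).
  have /andP[N0 Nn] := npos_bounds k' n w.
  case: n N0 Nn => [|n] N0 Nn; first by rewrite mul0r.
  by rewrite mulrC divfK // pnatr_eq0.
by case: k => /=; apply: le_trans (g _ _) _; rewrite ler_wpM2l // le_max lexx ?orbT.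
Qed.

Lemma count_diffE w : B_sum w = n1%:R * npos false n0 w - n0%:R * npos true n1 w.
Proof. by []. Qed.

Lemma bm_sum_sg (k : bool) n : bounded_meas (fun w => \sum_(i < n) Num.sg (Y k i w)).
Proof.
by apply: bm_sum => i; exact: (bm_comp (fun x : R => Num.sg x) (Y k i) (measurable_funPT _) bm_sg).
Qed.

Lemma bm_sum_sgB : bounded_meas (fun w => \sum_(i < n1) \sum_(j < n0) Num.sg (Y false j w - Y true i w)).
Proof.
apply: bm_sum => i; apply: bm_sum => j.
apply: (bm_comp (fun x : R => Num.sg x) (fun w => Y false j w - Y true i w)) bm_sg.
by apply: measurable_funB; exact: measurable_funPT.
Qed.

Lemma mann_whitney_samples w : on_samples Y (@mann_whitney R) n1 n0 w =
  (\sum_(i < n1) \sum_(j < n0) Num.sg (Y false j w - Y true i w)) / 2.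
Proof.
rewrite /on_samples mann_whitneyE big_mkseq; congr (_ / 2).
by apply: eq_bigr => i _; rewrite big_mkseq.
Qed.

Lemma bm_mann_whitney : bounded_meas (on_samples Y (@mann_whitney R) n1 n0).
Proof.
rewrite (funext mann_whitney_samples).
by apply: bmM; [exact: bm_sum_sgB|exact: bm_cst].
Qed.

Definition removed (k : bool) (n : nat) (w : T) : nat :=
  minn (rnd (n%:R * (1 - max_prop w))) (count_mem 0 (mkseq (fun i => Y k i w) n)).

Lemma zero_trimmed_samples w : on_samples Y (zero_trimmed rnd) n1 n0 w =
  (\sum_(i < n1) \sum_(j < n0) Num.sg (Y false j w - Y true i w)
   - (removed true n1 w)%:R * (\sum_(j < n0) Num.sg (Y false j w))
   + (removed false n0 w)%:R * (\sum_(i < n1) Num.sg (Y true i w))) / 2.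
Proof.
rewrite /on_samples zero_trimmedE !size_mkseq !pos_proportionE !big_mkseq.
by under eq_bigr do rewrite big_mkseq.
Qed.

Lemma bm_removed k n : bounded_meas (fun w => (removed k n w)%:R : R).
Proof.
split; last first.
  exists n%:R => w; rewrite normr_nat ler_nat (leq_trans (geq_minr _ _)) //.
  by rewrite (leq_trans (count_size _ _)) // size_mkseq.
pose c k n w := count [pred x | 0 < x] (mkseq (fun i => Y k i w) n).
have cE k' n' w : (c k' n' w)%:R = npos k' n' w by rewrite natr_count big_mkseq.
pose z w := count_mem 0 (mkseq (fun i => Y k i w) n).
(* The number of removed zeros depends on the data only through three counts: the positives of each
   sample and the zeros of sample [k]. *)
pose G a b e : R := (minn (rnd (n%:R * (1 - Num.max (a%:R / n0%:R) (b%:R / n1%:R)))) e)%:R.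
have -> : (fun w => (removed k n w)%:R) = (fun w => G (c false n0 w) (c true n1 w) (z w)).
  by apply/funext => w; rewrite /G !cE.
apply: measurable_nat3.
- by under eq_fun do rewrite cE; have [] := bm_npos false n0.
- by under eq_fun do rewrite cE; have [] := bm_npos true n1.
(* Negative values are excluded only almost surely, so here a zero is counted as neither positive
   nor negative. *)
- have zE w : (z w)%:R = \sum_(i < n) (1 - pos (Y k i w) - pos (- Y k i w)) :> R.
    rewrite natr_count big_mkseq; apply: eq_bigr => i _ /=; rewrite /pos oppr_gt0.
    by case: (ltgtP (Y k i w) 0) => _ /=; rewrite ?subr0 ?subrr.
  under eq_fun do rewrite zE.
  have : bounded_meas (fun w => \sum_(i < n) (1 - pos (Y k i w) - pos (- Y k i w)) : R).
    apply: bm_sum => i; apply: bmB.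
      by apply: bmB; [exact: bm_cst|exact: bm_posY].
    by apply: (bm_comp (@pos R) (fun w => - Y k i w)) bm_pos; apply: measurable_funN; exact: measurable_funPT.
  by case.
Qed.

Lemma bm_zero_trimmed : bounded_meas (on_samples Y (zero_trimmed rnd) n1 n0).
Proof.
rewrite (funext zero_trimmed_samples).
apply: bmM; last exact: bm_cst.
apply: bmD; last by apply: bmM; [exact: bm_removed|exact: bm_sum_sg].
by apply: bmB bm_sum_sgB _; apply: bmM; [exact: bm_removed|exact: bm_sum_sg].
Qed.

Lemma sum_sgB_nonneg w : (forall k i, 0 <= Y k i w) ->
  \sum_(i < n1) \sum_(j < n0) Num.sg (Y false j w - Y true i w) = A_sum w + B_sum w.
Proof.
move=> Y0; rewrite count_diffE /A_sum /pair_sum.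
transitivity (\sum_(i < n1) (\sum_(j < n0) pos_sg (obs (idx true n1 i) w) (obs (idx false n0 j) w)
    + (npos false n0 w - n0%:R * pos (Y true i w)))).
  apply: eq_bigr => i _; rewrite -sum_cst /npos -sumrB -big_split /=; apply: eq_bigr => j _.
  by rewrite sg_pos_sg.
by rewrite big_split sumrB sum_cst -mulr_sumr.
Qed.

(** Removing exactly n_k (1 - q) zeros would turn A + B into A + q B. Rounding changes each removal
    by at most 1, and this change is multiplied by the number of positives in the other sample. *)
Lemma zero_trimmed_approx w : rounding_rule rnd -> (forall k i, 0 <= Y k i w) ->
  `|2 * on_samples Y (zero_trimmed rnd) n1 n0 w - (A_sum w + max_prop w * B_sum w)| <=
  n0%:R + n1%:R.
Proof.
move=> rule Y0; rewrite zero_trimmed_samples sum_sgB_nonneg //.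
have sgE k n : \sum_(i < n) Num.sg (Y k i w) = npos k n w.
  by apply: eq_bigr => i _; rewrite sg_pos.
rewrite !sgE count_diffE.
have /andP[q0 q1] := max_prop_bounds w.
have rem_le k : let n := if k then n1 else n0 in
    `|n%:R * (1 - max_prop w) - (removed k n w)%:R| <= 1.
  move=> n; have x0 : 0 <= n%:R * (1 - max_prop w) by rewrite mulr_ge0 // subr_ge0.
  have r1 := rule _ x0; rewrite /removed (minn_idPl _) 1?distrC 1?ltW //.
  (* The [minn] is inactive: q is at least the proportion of positives, so n (1 - q) is at most the
     number of zeros, and rounding up by less than 1 cannot exceed that integer. *)
  rewrite -ltnS -(ltr_nat R) -natr1.
  have -> : (count_mem 0 (mkseq (fun i => Y k i w) n))%:R = n%:R - npos k n w :> R.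
    rewrite natr_count big_mkseq -[n%:R]mulr1 -sum_cst -sumrB; apply: eq_bigr => i _ /=.
    by rewrite /pos lt0r (Y0 k i) andbT; case: (Y k i w == 0); rewrite ?subr0 ?subrr.
  have := npos_le_max_prop k w; rewrite -/n => Nq.
  move: r1; rewrite ltr_norml => /andP[_ r1].
  by rewrite -ltrBlDr; apply: lt_le_trans (_ : n%:R * (1 - max_prop w) <= _);
    [rewrite ltrBlDr -ltrBlDl|rewrite mulrBr mulr1 lerD2l lerN2].
have := rem_le true; have := rem_le false => /=; set r0 := (removed false _ _)%:R; set r1 := (removed true _ _)%:R.
set q := max_prop w; set N0 := npos false n0 w; set N1 := npos true n1 w => e0 e1.
have -> : 2 * ((A_sum w + (n1%:R * N0 - n0%:R * N1) - r1 * N0 + r0 * N1) / 2) -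
    (A_sum w + q * (n1%:R * N0 - n0%:R * N1)) =
    (n1%:R * (1 - q) - r1) * N0 - (n0%:R * (1 - q) - r0) * N1 by field.
apply: le_trans (ler_normB _ _) _; rewrite !normrM.
have bN k n : `|npos k n w| <= n%:R.
  by have /andP[N_0 N_n] := npos_bounds k n w; rewrite ger0_norm.
apply: lerD; rewrite -[leRHS]mul1r ler_pM //; exact: bN.
Qed.

Hypothesis model : two_samples P Y.

Lemma obs_indep : mutually_independent P obs.
Proof. by case: model. Qed.

Lemma obs_law k i (A : set R) : measurable A -> P (Y k i @^-1` A) = P (Y k 0%N @^-1` A).
Proof. by case: model => _ same _; exact: same. Qed.

Lemma obs_zero_inflated ki : zero_inflated P (obs ki).
Proof.
case: model => _ _ /(_ ki.1) [neg0 at0]; split.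
  by rewrite obs_law //; exact: measurable_itv.
by move=> x x0; rewrite obs_law ?at0.
Qed.

Lemma obs_prob_pos ki : prob_pos P (obs ki) = prob_pos P (Y ki.1 0%N).
Proof. by rewrite /prob_pos obs_law //; exact: measurable_itv. Qed.

Lemma ae_nonneg : {ae P, forall w, forall k i, 0 <= Y k i w}.
Proof.
suff H k : {ae P, forall w, forall i, 0 <= Y k i w}.
  by apply: filterS2 (H true) (H false) => w Ht Hf [] i.
apply/ae_foralln => i; exists (Y k i @^-1` `]-oo, 0[); split.
- by apply: (measurable_preimage obs (k, i)); exact: measurable_itv.
- by have [] := obs_zero_inflated (k, i).
- by move=> w /= /negP; rewrite -ltNge in_itv.
Qed.

End Samples.

(** * Means of the two statistics under any effect size *)

Lemma dist_max {R : realType} (a b u v : R) :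
  `|Num.max a b - Num.max u v| <= `|a - u| + `|b - v|.
Proof.
have la := ler_norm (a - u); have lb := ler_norm (b - v).
have la' := ler_norm (u - a); have lb' := ler_norm (v - b).
rewrite [`|u - a|]distrC [`|v - b|]distrC in la' lb'.
have na := normr_ge0 (a - u); have nb := normr_ge0 (b - v).
by rewrite ler_norml; case: (leP a b) => ab; case: (leP u v) => uv; apply/andP; split; lra.
Qed.

(** Applied with observed proportions against true ones: q B / (n_0 n_1) has the form max (a, b) (a
    - b), which is Lipschitz on the unit square. *)
Lemma dist_max_mul {R : realType} (a b u v : R) :
  0 <= a <= 1 -> 0 <= b <= 1 -> 0 <= u <= 1 -> 0 <= v <= 1 ->
  `|Num.max a b * (a - b) - Num.max u v * (u - v)| <= 2 * (`|a - u| + `|b - v|).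
Proof.
move=> /andP[a0 a1] /andP[b0 b1] /andP[u0 u1] /andP[v0 v1].
have -> : Num.max a b * (a - b) - Num.max u v * (u - v) =
  (Num.max a b - Num.max u v) * (a - b) + Num.max u v * ((a - u) - (b - v)) by ring.
apply: le_trans (ler_normD _ _) _; rewrite mulr_natl mulr2n !normrM; apply: lerD.
  rewrite -[leRHS]mulr1 ler_pM ?dist_max // ler_norml; lra.
rewrite -[leRHS]mul1r ler_pM ?ler_normB // ger0_norm.
  by rewrite ge_max u1 v1.
by rewrite le_max u0.
Qed.

Section Samples.
Context {d} {T : measurableType d} {R : realType} (P : probability T R).
Context (Y : bool -> nat -> {mfun T >-> R}) (rnd : R -> nat).
Hypothesis model : two_samples P Y.
Hypothesis rule : rounding_rule rnd.
Context (n1 n0 : nat) (n1_gt0 : (0 < n1)%N) (n0_gt0 : (0 < n0)%N).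
Local Notation obs := (obs Y).
Local Notation A := (A_sum Y n1 n0).
Local Notation B := (B_sum Y n1 n0).
Local Notation q := (max_prop Y n1 n0).
Local Notation pk k := (prob_pos P (Y k 0%N)).
Local Notation indep := (obs_indep P Y model).
Local Notation W := (on_samples Y (@mann_whitney R) n1 n0).
Local Notation W' := (on_samples Y (zero_trimmed rnd) n1 n0).

Let n1R : 0 < n1%:R :> R. Proof. by rewrite ltr0n. Qed.
Let n0R : 0 < n0%:R :> R. Proof. by rewrite ltr0n. Qed.

Lemma idx_inj k n : injective (@idx k n).
Proof. by move=> i j [] /val_inj. Qed.

Lemma pk_bounds k : 0 <= pk k <= 1.
Proof.
have p0 := prob_pos_ge0 P (Y k) 0%N; have p1 := prob_pos_le1 P (Y k) 0%N.
by rewrite p0 p1.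
Qed.

Definition dev (k : bool) (n : nat) (w : T) : R := \sum_(i < n) centered P obs (idx k n i) w.

Lemma bm_dev k n : bounded_meas (dev k n).
Proof. by apply: bm_sum => i; exact: bm_centered. Qed.

Lemma devE k n w : dev k n w = npos Y k n w - n%:R * pk k.
Proof.
rewrite /dev /centered sumrB; congr (_ - _).
by rewrite -sum_cst; apply: eq_bigr => i _; rewrite obs_prob_pos.
Qed.

Lemma Ex_dev_sqr k n : Ex P (fun w => dev k n w ^+ 2) <= n%:R.
Proof.
rewrite (Ex_sum_centered_sqr P obs indep) ?ler_sum //; last exact: idx_inj.
rewrite -[leRHS]mulr1 -sum_cst; apply: ler_sum => i _; rewrite obs_prob_pos //.
by have /andP[] := pk_bounds k; nra.
Qed.

Lemma Ex_dev_4 k n : Ex P (fun w => dev k n w ^+ 4) <= 3 * n%:R ^+ 2.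
Proof. by apply: (Ex_sum_centered_4_le P obs indep); exact: idx_inj. Qed.

(** [Ex_mul_le] against the constant 1, with weight t = 1 / sqrt n, which balances its two terms. *)
Lemma Ex_dev_norm k n : (0 < n)%N -> Ex P (fun w => `|dev k n w|) <= Num.sqrt n%:R.
Proof.
move=> n0'; have bd := bm_dev k n.
have s0 : 0 < Num.sqrt n%:R :> R by rewrite sqrtr_gt0 ltr0n.
have sV : 0 < (Num.sqrt n%:R)^-1 :> R by rewrite invr_gt0.
have := Ex_mul_le P _ sV (bm_norm bd) (bm_cst 1); rewrite expr1n Ex_cst.
under eq_fun do rewrite mulr1.
under [X in _ <= (_ * Ex P X + _) / _]eq_fun do rewrite real_normK ?num_real //.
move=> /(le_trans (ler_norm _)) /le_trans; apply.
have e2 := Ex_dev_sqr k n.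
rewrite div1r invrK ler_pdivrMr // mulr_natr mulr2n lerD2r.
rewrite mulrC ler_pdivrMr // -expr2 sqr_sqrtr //; exact: ler0n.
Qed.

Lemma mw_ae : {ae P, forall w, W w = 2^-1 * (A w + B w)}.
Proof.
apply: filterS (ae_nonneg P Y model) => w Y0.
by rewrite mann_whitney_samples sum_sgB_nonneg // mulrC.
Qed.

Lemma Ex_B : Ex P B = n0%:R * n1%:R * (pk false - pk true).
Proof.
transitivity (Ex P (fun w => n1%:R * npos Y false n0 w - n0%:R * npos Y true n1 w)) => //.
have Enpos k n : Ex P (npos Y k n) = n%:R * pk k.
  rewrite Ex_sum => [|i]; last exact: bm_posY.
  rewrite -sum_cst; apply: eq_bigr => i _.
  by rewrite (Ex_pos P obs indep (k, nat_of_ord i)) obs_prob_pos.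
have b k n := bm_npos Y k n.
rewrite ExB ?ExZ ?Enpos; try by bounded.
ring.
Qed.

Hypothesis pk_gt0 : forall k, 0 < pk k.

Lemma Ex_A : Ex P A = - (n0%:R * n1%:R * (2 * intensity_effect P Y * (pk true * pk false))).
Proof.
rewrite Ex_sum; last by move=> i; apply: bm_sum => j; exact: bm_pos_sgX.
transitivity (\sum_(i < n1) \sum_(j < n0) - (2 * intensity_effect P Y * (pk true * pk false))); last first.
  by rewrite !sum_cst; ring.
apply: eq_bigr => i _; rewrite Ex_sum => [|j]; last exact: bm_pos_sgX.
apply: eq_bigr => j _.
have E00 := Ex_pos_sg P obs indep (true, 0%N) (false, 0%N) isT
  (obs_zero_inflated P Y model _) (pk_gt0 true) (pk_gt0 false).
transitivity (Ex P (fun w => pos_sg (obs (true, 0%N) w) (obs (false, 0%N) w))); last exact: E00.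
have sl k m m' : same_law P obs (k, m) (k, m').
  by move=> C mC; rewrite (obs_law P Y model k m) // (obs_law P Y model k m').
(* The third and fourth indices are dummies, chosen only to be distinct from the others on each
   side. *)
apply: (exchangeable P obs indep (fun x y _ _ => pos_sg x y) (true, nat_of_ord i) (false, nat_of_ord j)
  (true, i.+1) (true, i.+2) _ _ (true, 1%N) (true, 2%N)) => //.
- by rewrite /= !inE !xpair_eqE /=; lia.
- apply: bm_pos_sg; first exact: measurable_fst.
  exact: (measurableT_comp measurable_fst measurable_snd).
Qed.

Lemma Ex_mann_whitney : Ex P W = n0%:R * n1%:R *
  (- (2^-1 * (pk true - pk false + 2 * pk true * pk false * intensity_effect P Y))).
Proof.
have bA := bm_pair_sum obs _ _ (idx true n1) (idx false n0).
have bB := bm_count_diff obs _ _ (idx true n1) (idx false n0).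
rewrite (Ex_ae P _ _ mw_ae); last by apply: bmZ; apply: bmD.
  rewrite ExZ; last exact: bmD.
  rewrite (ExD P bA bB) -/A -/B Ex_A Ex_B; ring.
exact: bm_mann_whitney.
Qed.

Lemma zt_approx_mean : {ae P, forall w,
  `|2 * W' w - (A w + n0%:R * n1%:R * (Num.max (pk false) (pk true) * (pk false - pk true)))| <=
  n0%:R + n1%:R + 2 * (n1%:R * `|dev false n0 w| + n0%:R * `|dev true n1 w|)}.
Proof.
apply: filterS (ae_nonneg P Y model) => w Y0.
have := zero_trimmed_approx Y rnd n1 n0 w rule Y0.
set V := W' w; set M := Num.max _ _ => h.
have -> : 2 * V - (A w + n0%:R * n1%:R * (M * (pk false - pk true))) =
   (2 * V - (A w + q w * B w)) + (q w * B w - n0%:R * n1%:R * (M * (pk false - pk true))) by ring.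
apply: le_trans (ler_normD _ _) _; apply: lerD => //.
rewrite count_diffE; set a := npos Y false n0 w / n0%:R; set b := npos Y true n1 w / n1%:R.
have -> : q w * (n1%:R * npos Y false n0 w - n0%:R * npos Y true n1 w) -
    n0%:R * n1%:R * (M * (pk false - pk true)) =
  n0%:R * n1%:R * (Num.max a b * (a - b) - M * (pk false - pk true)).
  rewrite /max_prop -/a -/b.
  have -> : npos Y false n0 w = n0%:R * a by rewrite /a mulrC divfK // gt_eqF.
  have -> : npos Y true n1 w = n1%:R * b by rewrite /b mulrC divfK // gt_eqF.
  ring.
rewrite normrM ger0_norm; last by rewrite mulr_ge0 // ltW.
have := dist_max_mul a b (pk false) (pk true) (prop_bounds Y _ _ _) (prop_bounds Y _ _ _)
  (pk_bounds false) (pk_bounds true).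
move=> /(ler_wpM2l (ltW (mulr_gt0 n0R n1R))) /le_trans; apply.
have -> : `|dev false n0 w| = n0%:R * `|a - pk false|.
  by rewrite devE -[X in X * `|_|]gtr0_norm // -normrM mulrBr /a mulrCA divff ?gt_eqF // mulr1.
have -> : `|dev true n1 w| = n1%:R * `|b - pk true|.
  by rewrite devE -[X in X * `|_|]gtr0_norm // -normrM mulrBr /b mulrCA divff ?gt_eqF // mulr1.
by rewrite le_eqVlt; apply/orP; left; apply/eqP; ring.
Qed.

(** The error is of order 3/2 in the sample sizes, negligible against n_0 n_1; A enters with its
    exact mean, and only q B is approximated. *)
Lemma Ex_zero_trimmed : `|Ex P W' - n0%:R * n1%:R *
  (- (2^-1 * (Num.max (pk false) (pk true) * (pk true - pk false) +
     2 * pk true * pk false * intensity_effect P Y)))| <=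
  (n0%:R + n1%:R) / 2 + n1%:R * Num.sqrt n0%:R + n0%:R * Num.sqrt n1%:R.
Proof.
set M := Num.max _ _.
have bA : bounded_meas A by exact: bm_pair_sum.
have bW : bounded_meas W' by exact: bm_zero_trimmed.
have bd0 := bm_dev false n0; have bd1 := bm_dev true n1.
set c := n0%:R * n1%:R * (M * (pk false - pk true)).
have := Ex_ae_le P _ _ zt_approx_mean; rewrite -/c => /(_ _ _) h.
have {h} : Ex P (fun w => `|2 * W' w - (A w + c)|) <=
    n0%:R + n1%:R + 2 * (n1%:R * Num.sqrt n0%:R + n0%:R * Num.sqrt n1%:R).
  apply: le_trans (h _ _) _; try by bounded.
  rewrite ExD ?Ex_cst ?ExZ ?ExD ?ExZ; try by bounded.
  rewrite lerD2l ler_pM2l // lerD // ler_wpM2l //; try exact: Ex_dev_norm; exact: ltW.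
have b2 := bmB (bmZ 2 bW) (bmD bA (bm_cst c)).
move=> /(le_trans (Ex_norm P b2)).
rewrite (ExB P (bmZ 2 bW) (bmD bA (bm_cst c))) (ExZ P 2 bW) (ExD P bA (bm_cst c)) Ex_cst Ex_A /c.
by rewrite !ler_norml => /andP[l u]; apply/andP; split; lra.
Qed.

End Samples.

(** * Null variances of the two statistics *)

Lemma sqrD_le {R : realType} (x y : R) : (x + y) ^+ 2 <= 2 * x ^+ 2 + 2 * y ^+ 2.
Proof. by rewrite -subr_ge0 (_ : _ - _ = (x - y) ^+ 2) ?sqr_ge0 //; ring. Qed.

Lemma pow4D_le {R : realType} (x y : R) : (x + y) ^+ 4 <= 8 * (x ^+ 4 + y ^+ 4).
Proof.
rewrite (_ : (x + y) ^+ 4 = ((x + y) ^+ 2) ^+ 2); last by ring.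
apply: le_trans (_ : (2 * x ^+ 2 + 2 * y ^+ 2) ^+ 2 <= _).
  rewrite lerXn2r ?nnegrE ?sqr_ge0 ?sqrD_le //.
  by rewrite addr_ge0 // mulr_ge0 // sqr_ge0.
apply: le_trans (sqrD_le _ _) _; rewrite le_eqVlt; apply/orP; left; apply/eqP; ring.
Qed.

Section NullVariance.
Context {d} {T : measurableType d} {R : realType} (P : probability T R).
Context (Y : bool -> nat -> {mfun T >-> R}) (rnd : R -> nat) (p : R).
Hypothesis model : two_samples P Y.
Hypothesis rule : rounding_rule rnd.
Hypothesis same_groups : forall A : set R, measurable A ->
  distribution P (Y true 0%N) A = distribution P (Y false 0%N) A.
Hypothesis p_def : prob_pos P (Y false 0%N) = p.
Context (n1 n0 : nat) (n1_gt0 : (0 < n1)%N) (n0_gt0 : (0 < n0)%N).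
Local Notation obs := (obs Y).
Local Notation A := (A_sum Y n1 n0).
Local Notation B := (B_sum Y n1 n0).
Local Notation q := (max_prop Y n1 n0).
Local Notation indep := (obs_indep P Y model).
Local Notation zi := (obs_zero_inflated P Y model).
Local Notation W := (on_samples Y (@mann_whitney R) n1 n0).
Local Notation W' := (on_samples Y (zero_trimmed rnd) n1 n0).

Let n1R : 0 < n1%:R :> R. Proof. by rewrite ltr0n. Qed.
Let n0R : 0 < n0%:R :> R. Proof. by rewrite ltr0n. Qed.

Lemma fresh_obs (s : seq (bool * nat)) : exists i, i \notin s.
Proof.
exists (true, (\max_(x <- s) x.2).+1); apply/negP => h.
have := @leq_bigmax_seq _ s xpredT (fun x : bool * nat => x.2) _ h isT.
by rewrite /= ltnn.
Qed.

Lemma null_same_law i j : same_law P obs i j.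
Proof.
have same0 k : same_law P obs (k, 0%N) (false, 0%N).
  by case: k => // C mC; exact: same_groups.
by move: i j => [k m] [k' m'] C mC; rewrite !(obs_law P Y model _ _ C mC) (same0 k) // (same0 k').
Qed.

Lemma null_prob_pos i : prob_pos P (obs i) = p.
Proof.
rewrite -p_def /prob_pos (null_same_law i (false, 0%N)) //; exact: measurable_itv.
Qed.

Lemma idx_neq (i : 'I_n1) (j : 'I_n0) : idx true n1 i != idx false n0 j.
Proof. by []. Qed.

(** The null second moment of A + b B. At b = 1 it is four times the variance of W; at b = p it
    approximates four times that of W'. *)
Definition null_sqr (b : R) : R := n0%:R * n1%:R *
  (p ^+ 2 + (n0%:R + n1%:R - 2) * (p ^+ 3 / 3) + b ^+ 2 * (n0%:R + n1%:R) * (p * (1 - p))).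

Lemma bm_AB b : bounded_meas (fun w => A w + b * B w).
Proof. by apply: bmD; [exact: bm_pair_sum|exact/bmZ/bm_count_diff]. Qed.

Lemma Ex_AB_sqr b : Ex P (fun w => (A w + b * B w) ^+ 2) = null_sqr b.
Proof.
exact: (Ex_combination_sqr P obs indep fresh_obs null_same_law zi p null_prob_pos
  _ _ (idx_inj _ _) (idx_inj _ _) idx_neq).
Qed.

Lemma Ex_AB0 b : Ex P (fun w => A w + b * B w) = 0.
Proof.
have bA : bounded_meas A by exact: bm_pair_sum.
have bB : bounded_meas B by exact: bm_count_diff.
rewrite (ExD P bA (bmZ b bB)) (ExZ P b bB).
have -> : Ex P A = 0.
  exact: (Ex_pair_sum0 P obs indep fresh_obs null_same_law _ _ idx_neq).
have -> : Ex P B = 0 by exact: (Ex_count_diff0 P obs indep p null_prob_pos).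
by rewrite mulr0 addr0.
Qed.

Lemma var_mann_whitney : fine ('V_P[W])%E = null_sqr 1 / 4.
Proof.
have b1 := bm_AB 1; have bW := bm_mann_whitney Y n1 n0.
have WE : {ae P, forall w, W w = 2^-1 * (A w + 1 * B w)}.
  by apply: filterS (mw_ae P Y model n1 n0) => w; rewrite mul1r.
rewrite fine_varE // (Ex_ae P bW (bmZ _ b1) WE) (ExZ P _ b1) Ex_AB0 mulr0 expr0n subr0.
rewrite (Ex_ae P (bmX 2 bW) (bmZ 4^-1 (bmX 2 b1))).
  by rewrite (ExZ P _ (bmX 2 b1)) Ex_AB_sqr mulrC.
by apply: filterS WE => w ->; field.
Qed.

Definition residual (w : T) : R := 2 * W' w - (A w + p * B w).

Lemma bm_residual : bounded_meas residual.
Proof. by apply: bmB (bm_AB p); exact/bmZ/bm_zero_trimmed. Qed.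

(** Besides rounding, the residual is (q - p) B. The constant 16 is 2 from squaring a sum times 8
    from [pow4D_le]; the weights appear when deviations of proportions are written as [dev] over the
    sample size. *)
Lemma residual_sqr_ae : {ae P, forall w, residual w ^+ 2 <= 2 * (n0%:R + n1%:R) ^+ 2 +
  16 * (n1%:R ^+ 2 / n0%:R ^+ 2 * dev P Y false n0 w ^+ 4 +
        n0%:R ^+ 2 / n1%:R ^+ 2 * dev P Y true n1 w ^+ 4)}.
Proof.
apply: filterS (ae_nonneg P Y model) => w Y0.
have := zero_trimmed_approx Y rnd n1 n0 w rule Y0; rewrite /residual.
set V := W' w => h.
have -> : 2 * V - (A w + p * B w) = (2 * V - (A w + q w * B w)) + (q w - p) * B w by ring.
apply: le_trans (sqrD_le _ _) _; apply: lerD.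
  by rewrite ler_pM2l // -[X in X <= _]real_normK ?num_real // lerXn2r // ?nnegrE.
rewrite count_diffE !devE // p_def (_ : prob_pos P (Y true 0%N) = p); last first.
  exact: (null_prob_pos (true, 0%N)).
set a := npos Y false n0 w / n0%:R; set b := npos Y true n1 w / n1%:R.
have aE : npos Y false n0 w = n0%:R * a by rewrite /a mulrC divfK // gt_eqF.
have bE : npos Y true n1 w = n1%:R * b by rewrite /b mulrC divfK // gt_eqF.
have qp : `|q w - p| <= `|a - p| + `|b - p|.
  by have := dist_max a b p p; rewrite maxxx.
(* Both factors are at most |a - p| + |b - p|, so the squared product is at most its fourth
   power. *)
have key : ((q w - p) * (a - b)) ^+ 2 <= 8 * ((a - p) ^+ 4 + (b - p) ^+ 4).
  have -> : (a - p) ^+ 4 = `|a - p| ^+ 4 by rewrite -[RHS]normrX ger0_norm // (exprM _ 2 2) sqr_ge0.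
  have -> : (b - p) ^+ 4 = `|b - p| ^+ 4 by rewrite -[RHS]normrX ger0_norm // (exprM _ 2 2) sqr_ge0.
  apply: le_trans (pow4D_le _ _).
  rewrite -[X in X <= _]real_normK ?num_real // normrM (exprM _ 2 2).
  rewrite lerXn2r ?nnegrE ?mulr_ge0 ?sqr_ge0 // expr2 ler_pM //.
  by rewrite (_ : a - b = (a - p) - (b - p)) ?ler_normB //; ring.
have -> : 2 * ((q w - p) * (n1%:R * npos Y false n0 w - n0%:R * npos Y true n1 w)) ^+ 2 =
  2 * (n0%:R * n1%:R) ^+ 2 * ((q w - p) * (a - b)) ^+ 2 by rewrite aE bE; ring.
have -> : 16 * (n1%:R ^+ 2 / n0%:R ^+ 2 * (npos Y false n0 w - n0%:R * p) ^+ 4 +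
   n0%:R ^+ 2 / n1%:R ^+ 2 * (npos Y true n1 w - n1%:R * p) ^+ 4) =
   2 * (n0%:R * n1%:R) ^+ 2 * (8 * ((a - p) ^+ 4 + (b - p) ^+ 4)).
  by rewrite aE bE; field; rewrite !gt_eqF.
by rewrite ler_wpM2l // mulr_ge0 // sqr_ge0.
Qed.

(** The constant is 50 = 2 + 16 * 3, the 3 coming from the fourth moment bound. *)
Lemma Ex_residual_sqr : Ex P (fun w => residual w ^+ 2) <= 50 * (n0%:R + n1%:R) ^+ 2.
Proof.
have b0 := bmX 4 (bm_dev P Y false n0); have b1 := bmX 4 (bm_dev P Y true n1).
apply: le_trans (Ex_ae_le P (bmX 2 bm_residual) _ residual_sqr_ae) _; first by bounded.
rewrite ExD ?Ex_cst ?ExZ ?ExD ?ExZ; try by bounded.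
have e0 := Ex_dev_4 P Y model false n0; have e1 := Ex_dev_4 P Y model true n1.
set E0 := Ex P _ in e0 *; set E1 := Ex P _ in e1 *.
have m0 : n1%:R ^+ 2 / n0%:R ^+ 2 * E0 <= 3 * n1%:R ^+ 2.
  rewrite mulrAC ler_pdivrMr ?exprn_gt0 //.
  by rewrite [leRHS](_ : _ = n1%:R ^+ 2 * (3 * n0%:R ^+ 2)) ?ler_wpM2l ?sqr_ge0 //; ring.
have m1 : n0%:R ^+ 2 / n1%:R ^+ 2 * E1 <= 3 * n0%:R ^+ 2.
  rewrite mulrAC ler_pdivrMr ?exprn_gt0 //.
  by rewrite [leRHS](_ : _ = n0%:R ^+ 2 * (3 * n1%:R ^+ 2)) ?ler_wpM2l ?sqr_ge0 //; ring.
have : 0 <= n0%:R * n1%:R :> R by rewrite mulr_ge0 // ltW.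
move: m0 m1; set x := _ * E0; set y := _ * E1 => m0 m1.
rewrite (_ : (n0%:R + n1%:R) ^+ 2 = n0%:R ^+ 2 + 2 * (n0%:R * n1%:R) + n1%:R ^+ 2); [lra|ring].
Qed.

(** 2 W' is A + p B plus the residual. Twice the cross term is bounded by [Ex_mul_le], whose weight
    [t] stays free so that it may tend to 0 with the sample sizes. *)
Lemma var_zero_trimmed (t : R) : 0 < t ->
  `|4 * fine ('V_P[W'])%E - null_sqr p| <=
  t * null_sqr p + 50 * (n0%:R + n1%:R) ^+ 2 / t + 100 * (n0%:R + n1%:R) ^+ 2.
Proof.
move=> t0; have bW := bm_zero_trimmed Y rnd n1 n0; have bD := bm_AB p; have br := bm_residual.
rewrite fine_varE //.
have E1 : Ex P W' = 2^-1 * Ex P residual.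
  rewrite -[Ex P residual]add0r -(Ex_AB0 p) -(ExD P bD br) -(ExZ P _ (bmD bD br)).
  by congr (Ex P); apply/funext => w; rewrite /residual; field.
have E2 : Ex P (fun w => W' w ^+ 2) = 4^-1 * (null_sqr p +
    2 * Ex P (fun w => (A w + p * B w) * residual w) + Ex P (fun w => residual w ^+ 2)).
  rewrite -Ex_AB_sqr -(ExZ P _ (bmM bD br)) -(ExD P (bmX 2 bD) (bmZ 2 (bmM bD br))).
  rewrite -(ExD P (bmD (bmX 2 bD) (bmZ 2 (bmM bD br))) (bmX 2 br)).
  rewrite -(ExZ P _ (bmD (bmD (bmX 2 bD) (bmZ 2 (bmM bD br))) (bmX 2 br))).
  by congr (Ex P); apply/funext => w; rewrite /residual; field.
rewrite E1 E2; have := Ex_mul_le P t t0 bD br; rewrite Ex_AB_sqr.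
have := Ex_residual_sqr; have := Ex_sqr_le P br; have := sqr_ge0 (Ex P residual).
set m := Ex P residual; set r2 := Ex P (fun w => residual w ^+ 2); set x := Ex P _.
set N := (n0%:R + n1%:R) ^+ 2 => m0 mr rN.
have rt : r2 / t <= 50 * N / t by rewrite ler_pM2r // invr_gt0.
rewrite !ler_norml exprMn => /andP[l u].
have -> : 4 * (4^-1 * (null_sqr p + 2 * x + r2) - 2^-1 ^+ 2 * m ^+ 2) - null_sqr p =
  2 * x + r2 - m ^+ 2 by field.
by apply/andP; split; lra.
Qed.

End NullVariance.

(** * Limits *)

Lemma cvg_dist_le {R : realType} {T : Type} (F : set_system T) {FF : Filter F}
    (f e : T -> R) (l : R) :
  (\forall x \near F, `|f x - l| <= e x) -> e x @[x --> F] --> (0 : R) -> f x @[x --> F] --> l.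
Proof.
move=> fe e0; apply/subr_cvg0; apply: (@squeeze_cvgr _ _ _ _ (fun x => - e x) e) => //.
  by near=> x; rewrite -ler_norml; near: x.
by rewrite -oppr0; exact: cvgN.
Unshelve. all: by end_near. Qed.

Lemma cvg_natrV0 {R : realType} (n : nat -> nat) : n k @[k --> \oo] --> \oo ->
  ((n k)%:R^-1 : R) @[k --> \oo] --> (0 : R).
Proof.
move=> noo.
have gt0 : \forall m \near \oo, (0 < m)%N by exact: nbhs_infty_gt.
have nk0 : \forall k \near \oo, 0 < (n k)%:R :> R.
  have ngt0 : \forall k \near \oo, (0 < n k)%N by exact: noo gt0.
  by apply: filterS ngt0 => k; rewrite ltr0n.
exact: (gtr0_cvgV0 nk0).2 (cvg_comp _ _ noo cvgr_idn).
Qed.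

Lemma cvg_sqrt0 {R : realType} (f : nat -> R) :
  f k @[k --> \oo] --> (0 : R) -> Num.sqrt (f k) @[k --> \oo] --> (0 : R).
Proof.
move=> f0; rewrite -[X in _ --> X]sqrtr0.
exact: (cvg_comp _ _ f0 (@sqrt_continuous R 0)).
Qed.

Lemma cvg_addr0 {R : realType} (f g : nat -> R) : f k @[k --> \oo] --> (0 : R) ->
  g k @[k --> \oo] --> (0 : R) -> (f k + g k) @[k --> \oo] --> (0 : R).
Proof. by move=> f0 g0; rewrite -[X in _ --> X]addr0; exact: cvgD. Qed.

Lemma cvg_mull0 {R : realType} {T : Type} (F : set_system T) {FF : Filter F} (c : R) (f : T -> R) :
  f k @[k --> F] --> (0 : R) -> (c * f k) @[k --> F] --> (0 : R).
Proof. by move=> f0; rewrite -[X in _ --> X](mulr0 c); apply: cvgM f0; exact: cvg_cst. Qed.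

Lemma cvg_within_norm0 {R : realType} (V : set R) :
  `|nu| @[nu --> within V (0 : R)^'] --> (0 : R).
Proof.
apply: cvg_within_filter; apply: cvg_within_filter.
have h : `|nu| @[nu --> (0 : R)] --> `|0 : R| by apply: cvg_norm; exact: cvg_id.
by rewrite normr0 in h.
Qed.

Section Asymptotics.
Context {R : realType} (n1 n0 : nat -> nat).
Hypothesis n1_infty : n1 k @[k --> \oo] --> \oo.
Hypothesis n0_infty : n0 k @[k --> \oo] --> \oo.

Let x k : R := (n0 k)%:R^-1.
Let y k : R := (n1 k)%:R^-1.

Let x0 : x k @[k --> \oo] --> (0 : R). Proof. exact: cvg_natrV0. Qed.
Let y0 : y k @[k --> \oo] --> (0 : R). Proof. exact: cvg_natrV0. Qed.

Lemma near_sizes_gt0 : \forall k \near \oo, (0 < n1 k)%N /\ (0 < n0 k)%N.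
Proof.
have gt0 : \forall m \near \oo, (0 < m)%N by exact: nbhs_infty_gt.
have n1gt0 : \forall k \near \oo, (0 < n1 k)%N by exact: n1_infty gt0.
have n0gt0 : \forall k \near \oo, (0 < n0 k)%N by exact: n0_infty gt0.
by apply: filterS2 n1gt0 n0gt0 => k; split.
Qed.

(** Divided by n_0 n_1 the bound becomes half of 1 / n_0 + 1 / n_1 plus 1 / sqrt n_0 + 1 / sqrt n_1.
    The mean of W, known exactly, fits the same bound. *)
Lemma cvg_mean_of_bound (f : nat -> nat -> R) (l : R) :
  (forall m1 m0, (0 < m1)%N -> (0 < m0)%N -> `|f m1 m0 - m0%:R * m1%:R * l| <=
     (m0%:R + m1%:R) / 2 + m1%:R * Num.sqrt m0%:R + m0%:R * Num.sqrt m1%:R) ->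
  (f (n1 k) (n0 k) / ((n0 k)%:R * (n1 k)%:R)) @[k --> \oo] --> l.
Proof.
move=> fl; apply: (@cvg_dist_le _ _ _ _ _
  (fun k => 2^-1 * (x k + y k) + (Num.sqrt (x k) + Num.sqrt (y k)))); last first.
  by do 2?[apply: cvg_addr0]; [apply: cvg_mull0; exact: cvg_addr0|exact: cvg_sqrt0|exact: cvg_sqrt0].
apply: filterS near_sizes_gt0 => k [m1 m0]; rewrite /x /y.
have := fl _ _ m1 m0; set a : R := (n0 k)%:R; set b : R := (n1 k)%:R => h.
have a0 : 0 < a by rewrite ltr0n. have b0 : 0 < b by rewrite ltr0n.
have ab := mulr_gt0 a0 b0.
have -> : f (n1 k) (n0 k) / (a * b) - l = (f (n1 k) (n0 k) - a * b * l) / (a * b).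
  by field; rewrite !gt_eqF.
rewrite normrM [`|(a * b)^-1|]gtr0_norm ?invr_gt0 // ler_pdivrMr //.
apply: le_trans h _; rewrite le_eqVlt; apply/orP; left; apply/eqP.
have sV (c : R) : 0 < c -> c * Num.sqrt c^-1 = Num.sqrt c.
  move=> c0; rewrite -{1}[c]sqr_sqrtr ?ltW // sqrtrV ?ltW // expr2 mulfK //.
  by rewrite gt_eqF // sqrtr_gt0.
rewrite -(sV a) // -(sV b) //; field; by rewrite !gt_eqF.
Qed.

(** Four times a normalized limiting variance; at p = b = 1 it is 1/3, which gives back the untied
    value 1/12. *)
Definition null_zeta (p b : R) : R := p ^+ 3 / 3 + b ^+ 2 * (p * (1 - p)).

Let nrm (m1 m0 : nat) : R := m0%:R * m1%:R * (m0%:R + m1%:R).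

Lemma null_sqr_dist p b m1 m0 : (0 < m1)%N -> (0 < m0)%N ->
  `|null_sqr p m1 m0 b / nrm m1 m0 - null_zeta p b| <= `|p ^+ 2 - 2 * (p ^+ 3 / 3)| * m0%:R^-1.
Proof.
move=> m1_gt0 m0_gt0.
have a0 : 0 < m0%:R :> R by rewrite ltr0n. have b0 : 0 < m1%:R :> R by rewrite ltr0n.
have ab := addr_gt0 a0 b0.
have -> : null_sqr p m1 m0 b / nrm m1 m0 - null_zeta p b =
    (p ^+ 2 - 2 * (p ^+ 3 / 3)) / (m0%:R + m1%:R).
  by rewrite /null_sqr /nrm /null_zeta; field; rewrite !gt_eqF.
rewrite normrM [`|(_ + _)^-1|]gtr0_norm ?invr_gt0 // ler_wpM2l // lef_pV2 ?posrE //.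
by rewrite lerDl ltW.
Qed.

Lemma cvg_null_sqr p b :
  (null_sqr p (n1 k) (n0 k) b / nrm (n1 k) (n0 k)) @[k --> \oo] --> null_zeta p b.
Proof.
apply: (@cvg_dist_le _ _ _ _ _ (fun k => `|p ^+ 2 - 2 * (p ^+ 3 / 3)| * x k)); last exact: cvg_mull0.
by apply: filterS near_sizes_gt0 => k [m1 m0]; exact: null_sqr_dist.
Qed.

Lemma cvg_unadjusted_var :
  (unadjusted_var R (n1 k) (n0 k) / nrm (n1 k) (n0 k)) @[k --> \oo] --> (12^-1 : R).
Proof.
apply: (@cvg_dist_le _ _ _ _ _ (fun k => 12^-1 * x k)); last exact: cvg_mull0.
apply: filterS near_sizes_gt0 => k [m1 m0]; rewrite /x /unadjusted_var /nrm.
have a0 : 0 < (n0 k)%:R :> R by rewrite ltr0n. have b0 : 0 < (n1 k)%:R :> R by rewrite ltr0n.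
have ab := addr_gt0 a0 b0.
rewrite (_ : _ - _ = 12^-1 * ((n0 k)%:R + (n1 k)%:R)^-1); last by field; rewrite !gt_eqF.
rewrite ger0_norm ?ler_wpM2l ?mulr_ge0 ?invr_ge0 ?(ltW ab) // lef_pV2 ?posrE //.
by rewrite lerDl ltW.
Qed.

Lemma cvg_var_of_bound (v : nat -> nat -> R) (p b : R) :
  (forall m1 m0 t, (0 < m1)%N -> (0 < m0)%N -> 0 < t ->
    `|4 * v m1 m0 - null_sqr p m1 m0 b| <=
    t * null_sqr p m1 m0 b + 50 * (m0%:R + m1%:R) ^+ 2 / t + 100 * (m0%:R + m1%:R) ^+ 2) ->
  (v (n1 k) (n0 k) / nrm (n1 k) (n0 k)) @[k --> \oo] --> null_zeta p b / 4.
Proof.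
move=> vb; set C := null_zeta p b.
suff : (4 * (v (n1 k) (n0 k) / nrm (n1 k) (n0 k))) @[k --> \oo] --> C.
  move=> h; rewrite (_ : (fun k => v (n1 k) (n0 k) / nrm (n1 k) (n0 k)) =
    (fun k => 4^-1 * (4 * (v (n1 k) (n0 k) / nrm (n1 k) (n0 k))))); last first.
    by apply/funext => k; rewrite mulKf.
  by rewrite mulrC; apply: cvgM h; exact: cvg_cst.
pose r k := null_sqr p (n1 k) (n0 k) b / nrm (n1 k) (n0 k).
have rC : r k @[k --> \oo] --> C by exact: cvg_null_sqr.
(* The weight t: the first error term becomes of order t and the second of order (1 / n_0 + 1 / n_1)
   / t, so the square root makes both vanish. *)
pose s k := Num.sqrt (x k + y k).
have s0 : s k @[k --> \oo] --> (0 : R) by apply: cvg_sqrt0; exact: cvg_addr0.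
apply: (@cvg_dist_le _ _ _ _ _ (fun k => s k * r k + 50 * s k + 100 * (x k + y k) + `|r k - C|)).
  apply: filterS near_sizes_gt0 => k [m1 m0].
  have a0 : 0 < (n0 k)%:R :> R by rewrite ltr0n. have b0 : 0 < (n1 k)%:R :> R by rewrite ltr0n.
  have xy0 : 0 < x k + y k by rewrite addr_gt0 // invr_gt0.
  have sk0 : 0 < s k by rewrite sqrtr_gt0.
  have := vb _ _ _ m1 m0 sk0.
  have nr0 : 0 < nrm (n1 k) (n0 k) by rewrite !mulr_gt0 // addr_gt0.
  have sq : s k ^+ 2 = x k + y k by rewrite sqr_sqrtr // ltW.
  have NE : ((n0 k)%:R + (n1 k)%:R) ^+ 2 = (x k + y k) * nrm (n1 k) (n0 k) :> R.
    by rewrite /x /y /nrm; field; rewrite !gt_eqF.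
  rewrite NE (_ : 50 * ((x k + y k) * nrm (n1 k) (n0 k)) / s k = 50 * s k * nrm (n1 k) (n0 k)); last first.
    by rewrite -sq; field; rewrite gt_eqF.
  move=> h; have -> : 4 * (v (n1 k) (n0 k) / nrm (n1 k) (n0 k)) - C =
    (4 * v (n1 k) (n0 k) - null_sqr p (n1 k) (n0 k) b) / nrm (n1 k) (n0 k) + (r k - C).
    by rewrite /r; field; rewrite gt_eqF.
  apply: le_trans (ler_normD _ _) _; apply: lerD => //.
  rewrite normrM [`|_^-1|]gtr0_norm ?invr_gt0 // ler_pdivrMr //.
  apply: le_trans h _; rewrite le_eqVlt; apply/orP; left; apply/eqP.
  by rewrite /r; field; rewrite gt_eqF.
do 3?[apply: cvg_addr0].
- by rewrite -[X in _ --> X](mul0r C); exact: cvgM.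
- exact: cvg_mull0.
- by apply: cvg_mull0; exact: cvg_addr0.
- by apply/norm_cvg0P; apply/subr_cvg0.
Qed.

End Asymptotics.

(** * Efficacies and the two Pitman efficiencies *)

Lemma efficacy_slope {R : realType} (V : set R) (mu : R -> R) (l C : R) :
  mu 0 = 0 -> (forall nu, nu != 0 -> `|mu nu / nu - l| <= C * `|nu|) ->
  ((mu nu - mu 0) / nu) @[nu --> within V (0 : R)^'] --> l.
Proof.
move=> mu0 mul; apply: (@cvg_dist_le _ _ _ _ _ (fun nu => C * `|nu|)); last first.
  by apply: cvg_mull0; exact: cvg_within_norm0.
have neq0 : \forall nu \near (0 : R)^', nu != 0 by exact: nbhs_dnbhs_neq.
have : \forall nu \near within V (0 : R)^', nu != 0 by exact: cvg_within neq0.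
by apply: filterS => nu nu0; rewrite mu0 subr0; exact: mul.
Qed.

Lemma pitman_efficiencyP {R : realType} (V : set R) (n1 n0 : nat -> nat)
    (mean1 mean2 : R -> nat -> nat -> R) (var1 var2 : nat -> nat -> R)
    (mu1 mu2 : R -> R) (l1 l2 v1 v2 : R) :
  (forall nu, V nu ->
     (mean1 nu (n1 k) (n0 k) / ((n0 k)%:R * (n1 k)%:R)) @[k --> \oo] --> mu1 nu) ->
  (forall nu, V nu ->
     (mean2 nu (n1 k) (n0 k) / ((n0 k)%:R * (n1 k)%:R)) @[k --> \oo] --> mu2 nu) ->
  ((mu1 nu - mu1 0) / nu) @[nu --> within V (0 : R)^'] --> l1 ->
  ((mu2 nu - mu2 0) / nu) @[nu --> within V (0 : R)^'] --> l2 ->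
  0 < v1 -> 0 < v2 -> l2 != 0 ->
  (var1 (n1 k) (n0 k) / ((n0 k)%:R * (n1 k)%:R * ((n0 k)%:R + (n1 k)%:R)))
    @[k --> \oo] --> v1 ->
  (var2 (n1 k) (n0 k) / ((n0 k)%:R * (n1 k)%:R * ((n0 k)%:R + (n1 k)%:R)))
    @[k --> \oo] --> v2 ->
  is_pitman_efficiency V n1 n0 mean1 var1 mean2 var2 (v2 / v1 * (l1 / l2) ^+ 2).
Proof.
move=> m1 m2 d1 d2 v1_gt0 v2_gt0 l2_neq0 c1 c2.
have s1 : 0 < Num.sqrt v1 by rewrite sqrtr_gt0.
have s2 : 0 < Num.sqrt v2 by rewrite sqrtr_gt0.
exists (l1 / Num.sqrt v1), (l2 / Num.sqrt v2); split.
- by exists mu1, l1, (Num.sqrt v1); rewrite sqr_sqrtr ?ltW.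
- by exists mu2, l2, (Num.sqrt v2); rewrite sqr_sqrtr ?ltW.
- by rewrite mulf_neq0 // invr_eq0 gt_eqF.
- rewrite -{1}(sqr_sqrtr (ltW v1_gt0)) -{1}(sqr_sqrtr (ltW v2_gt0)).
  by field; rewrite l2_neq0 !gt_eqF.
Qed.

Theorem theorem1 (R : realType) (disp : measure_display) (T : measurableType disp)
    (P : R -> probability T R) (Y : bool -> nat -> {mfun T >-> R})
    (p phi : R) (V : set R) (rnd : R -> nat) (n1 n0 : nat -> nat) (lambda : R)
    (p_gt0 : 0 < p) (p_le1 : p <= 1) (phi_ge0 : 0 <= phi) (phi_le : phi <= pi / 2)
    (V0 : V 0) (V_lim : limit_point V 0)
    (model : forall nu : R, V nu -> two_samples (P nu) Y)
    (pos_prob : forall nu : R, V nu ->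
       0 < prob_pos (P nu) (Y true 0%N) /\ prob_pos (P nu) (Y false 0%N) = p)
    (same_law : forall A : set R, measurable A ->
       distribution (P 0) (Y true 0%N) A = distribution (P 0) (Y false 0%N) A)
    (m_dir : forall nu : R, V nu -> incidence_effect (P nu) Y = nu * cos phi)
    (d_dir : forall nu : R, V nu -> intensity_effect (P nu) Y = nu * sin phi)
    (rnd_rule : rounding_rule rnd)
    (n1_infty : n1 k @[k --> \oo] --> \oo) (n0_infty : n0 k @[k --> \oo] --> \oo)
    (lambda_gt0 : 0 < lambda) (lambda_lt1 : lambda < 1)
    (ratio : ((n1 k)%:R / ((n0 k)%:R + (n1 k)%:R) : R) @[k --> \oo] --> lambda) :
  let W := @mann_whitney R in
  let W' := zero_trimmed rnd in
  let mean S := fun nu => stat_mean (P nu) Y S in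
  let null_var S := stat_var (P 0) Y S in
  [/\ forall nu : R, V nu ->
        (null_hyp (incidence_effect (P nu) Y) (intensity_effect (P nu) Y) <-> nu = 0) /\
        (alt_hyp (incidence_effect (P nu) Y) (intensity_effect (P nu) Y) <-> 0 < nu),
      is_pitman_efficiency V n1 n0
        (mean W') (null_var W') (mean W) (unadjusted_var R)
        ((1 / 3) / (p ^+ 3 - p ^+ 4 + p ^+ 3 / 3) *
         ((p * cos phi + 2 * p ^+ 2 * sin phi) /
          (cos phi + 2 * p ^+ 2 * sin phi)) ^+ 2) &
      is_pitman_efficiency V n1 n0
        (mean W') (null_var W') (mean W) (null_var W)
        ((1 - p + p ^+ 2 / 3) / (p ^+ 2 - p ^+ 3 + p ^+ 2 / 3) *
         ((p * cos phi + 2 * p ^+ 2 * sin phi) /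
          (cos phi + 2 * p ^+ 2 * sin phi)) ^+ 2)].
Proof.
move=> W W' mean null_var.
have pi0 : 0 <= pi / 2 :> R by apply: le_trans phi_le.
have c0 : 0 <= cos phi.
  by apply: cos_ge0_pihalf; rewrite phi_le andbT (le_trans _ phi_ge0) // oppr_le0.
have s0 : 0 <= sin phi.
  by apply: sin_ge0_pi; rewrite phi_ge0 (le_trans phi_le) // ler_pdivrMr // ler_peMr ?pi_ge0 // ler1n.
(* This makes the slope of W nonzero and lets the effects determine the sign of nu. *)
have cs0 : (0 < cos phi) || (0 < sin phi).
  rewrite !lt0r c0 s0 !andbT -negb_and; apply/negP => /andP[/eqP E /eqP F].
  by have := cos2Dsin2 phi; rewrite E F expr0n addr0 => /eqP; rewrite eq_sym oner_eq0.
have p2_gt0 : 0 < 2 * p ^+ 2 by rewrite mulr_gt0 // exprn_gt0.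
have l_gt0 : 0 < cos phi + 2 * p ^+ 2 * sin phi.
  case/orP: cs0 => h; first by rewrite ltr_pwDl // mulr_ge0 // ltW.
  by rewrite ltr_wpDl // mulr_gt0.
have pT nu : V nu -> prob_pos (P nu) (Y true 0%N) = p + nu * cos phi.
  move=> Vnu; have := m_dir nu Vnu; rewrite /incidence_effect (pos_prob nu Vnu).2 => <-.
  by rewrite addrC subrK.
have pk nu : V nu -> forall k, 0 < prob_pos (P nu) (Y k 0%N).
  by move=> Vnu; have [pt pf] := pos_prob nu Vnu; case => //; rewrite pf.
(* Limiting means with p_1 = p + nu cos phi and p_0 = p; the minus sign, due to descending ranks,
   cancels in the ratio of slopes. *)
pose muW (nu : R) := - (2^-1 * (nu * cos phi + 2 * (p + nu * cos phi) * p * (nu * sin phi))).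
pose muW' (nu : R) := - (2^-1 * (Num.max p (p + nu * cos phi) * (nu * cos phi) +
   2 * (p + nu * cos phi) * p * (nu * sin phi))).
have meanW nu : V nu ->
    (mean W nu (n1 k) (n0 k) / ((n0 k)%:R * (n1 k)%:R)) @[k --> \oo] --> muW nu.
  move=> Vnu; apply: (cvg_mean_of_bound n1 n0 n1_infty n0_infty (mean W nu)) => m1 m0 m1_gt0 m0_gt0.
  rewrite -[mean W nu m1 m0]/(Ex (P nu) (on_samples Y W m1 m0)).
  rewrite (Ex_mann_whitney (P nu) Y (model nu Vnu) m1 m0 m1_gt0 m0_gt0 (pk nu Vnu)).
  rewrite pT // (pos_prob nu Vnu).2 d_dir // (_ : _ - _ = 0); last by rewrite /muW; ring.
  by rewrite normr0; do ?[exact: ler0n|exact: sqrtr_ge0|by rewrite invr_ge0|apply: addr_ge0|apply: mulr_ge0].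
have meanW' nu : V nu ->
    (mean W' nu (n1 k) (n0 k) / ((n0 k)%:R * (n1 k)%:R)) @[k --> \oo] --> muW' nu.
  move=> Vnu; apply: (cvg_mean_of_bound n1 n0 n1_infty n0_infty (mean W' nu)) => m1 m0 m1_gt0 m0_gt0.
  have := Ex_zero_trimmed (P nu) Y rnd (model nu Vnu) rnd_rule m1 m0 m1_gt0 m0_gt0 (pk nu Vnu).
  rewrite pT // (pos_prob nu Vnu).2 d_dir //.
  by rewrite (_ : p + nu * cos phi - p = nu * cos phi) //; ring.
have slopeW : ((muW nu - muW 0) / nu) @[nu --> within V (0 : R)^'] -->
    - (2^-1 * (cos phi + 2 * p ^+ 2 * sin phi)).
  apply: (efficacy_slope V muW _ (`|p * cos phi * sin phi|)).
    by rewrite /muW; ring.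
  (* The only second order term comes from p_1 = p + nu cos phi in the intensity part. *)
  move=> nu nu0; rewrite (_ : _ - _ = - (p * cos phi * sin phi) * nu); last by rewrite /muW; field.
  by rewrite normrM normrN.
have slopeW' : ((muW' nu - muW' 0) / nu) @[nu --> within V (0 : R)^'] -->
    - (2^-1 * (p * cos phi + 2 * p ^+ 2 * sin phi)).
  apply: (efficacy_slope V muW' _ (`|p * cos phi * sin phi| + `|cos phi| * `|cos phi|)).
    by rewrite /muW'; ring.
  (* For W' the maximum adds a second remainder: it differs from p by at most |nu cos phi| and is
     multiplied by cos phi / 2. *)
  move=> nu nu0; rewrite (_ : _ - _ = - (p * cos phi * sin phi) * nu +
    - (2^-1 * cos phi) * (Num.max p (p + nu * cos phi) - p)); last by rewrite /muW'; field.
  apply: le_trans (ler_normD _ _) _; rewrite mulrDl; apply: lerD.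
    by rewrite normrM normrN.
  have mx : `|Num.max p (p + nu * cos phi) - p| <= `|cos phi| * `|nu|.
    have := dist_max p (p + nu * cos phi) p p; rewrite maxxx subrr normr0 add0r.
    by move=> /le_trans; apply; rewrite addrC addKr normrM mulrC.
  have half : `|2^-1 : R| <= 1 by rewrite ger0_norm // invf_le1 // ler1n.
  rewrite normrM normrN normrM -!mulrA -[leRHS]mul1r ler_pM ?mulr_ge0 //.
  by rewrite ler_wpM2l.
have p0 := (pos_prob 0 V0).2.
have z_gt0 b : b != 0 -> 0 < null_zeta p b / 4.
  move=> b0; rewrite divr_gt0 // ltr_pwDl //; first by rewrite divr_gt0 // exprn_gt0.
  by rewrite mulr_ge0 ?sqr_ge0 // mulr_ge0 ?subr_ge0 // ltW.
have varW : (null_var W (n1 k) (n0 k) / ((n0 k)%:R * (n1 k)%:R * ((n0 k)%:R + (n1 k)%:R)))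
    @[k --> \oo] --> null_zeta p 1 / 4.
  apply: (cvg_var_of_bound n1 n0 n1_infty n0_infty (null_var W)) => m1 m0 t m1_gt0 m0_gt0 t0.
  rewrite -[null_var W m1 m0]/(fine ('V_(P 0%R)[on_samples Y W m1 m0])%E).
  rewrite (var_mann_whitney (P 0) Y p (model 0 V0) same_law p0 m1 m0).
  rewrite (_ : _ - _ = 0); last by field.
  have ns0 : 0 <= null_sqr p m1 m0 1.
    rewrite -(Ex_AB_sqr (P 0) Y p (model 0 V0) same_law p0 m1 m0 1).
    by apply: Ex_ge0 => w; exact: sqr_ge0.
  by rewrite normr0; do ?[exact: ns0|exact: sqr_ge0|exact: ltW|exact: ler0n|by rewrite invr_ge0 ltW|apply: addr_ge0|apply: mulr_ge0].
have varW' : (null_var W' (n1 k) (n0 k) / ((n0 k)%:R * (n1 k)%:R * ((n0 k)%:R + (n1 k)%:R)))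
    @[k --> \oo] --> null_zeta p p / 4.
  apply: (cvg_var_of_bound n1 n0 n1_infty n0_infty (null_var W')) => m1 m0 t m1_gt0 m0_gt0 t0.
  exact: (var_zero_trimmed (P 0) Y rnd p (model 0 V0) rnd_rule same_law p0 m1 m0 m1_gt0 m0_gt0 t t0).
have l2 : - (2^-1 * (cos phi + 2 * p ^+ 2 * sin phi)) != 0.
  by rewrite oppr_eq0 mulf_neq0 ?gt_eqF // invr_gt0.
have zp : 0 < null_zeta p p by have := z_gt0 p (lt0r_neq0 p_gt0); rewrite pmulr_lgt0 // invr_gt0.
have d_neq0 : p ^+ 2 - p ^+ 3 + p ^+ 2 / 3 != 0.
  rewrite gt_eqF // -(pmulr_rgt0 _ p_gt0).
  by rewrite [X in 0 < X](_ : _ = null_zeta p p) // /null_zeta; ring.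
split.
- move=> nu Vnu; rewrite /null_hyp /alt_hyp m_dir // d_dir //; split.
    split=> [[/eqP m0 /eqP d0]|->]; last by rewrite !mul0r.
    move: m0 d0; rewrite !mulf_eq0; case: (eqVneq nu 0) => //= _ m0 d0.
    by move: cs0; rewrite (eqP m0) (eqP d0) ltxx.
  split=> [/eqP|nu0].
    (* For nu <= 0 neither effect is positive, so both factors would equal 1. *)
    rewrite mulf_eq0 [0 < nu]ltNge => H; apply/negP => nu0; move: H.
    have nonpos (z : R) : 0 <= z -> (0 < nu * z) = false.
      by move=> z0; apply/negbTE; rewrite -leNgt mulr_le0_ge0.
    by rewrite !nonpos // subr0 oner_eq0.
  by case/orP: cs0 => h; rewrite (mulr_gt0 nu0 h) subrr ?mul0r ?mulr0.
- set r := (X in is_pitman_efficiency _ _ _ _ _ _ _ X).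
  have -> : r = 12^-1 / (null_zeta p p / 4) *
      ((- (2^-1 * (p * cos phi + 2 * p ^+ 2 * sin phi))) /
       (- (2^-1 * (cos phi + 2 * p ^+ 2 * sin phi)))) ^+ 2.
    (* The numerator 1/3 of the claim is 1/12 divided by the 1/4 of the variance of W'. *)
    have -> : null_zeta p p = p ^+ 3 - p ^+ 4 + p ^+ 3 / 3 by rewrite /null_zeta; ring.
    rewrite /r invrN mulrNN; field.
    by rewrite (gt_eqF l_gt0) /= (_ : _ + _ = 3 * null_zeta p p) ?mulf_neq0 ?gt_eqF // /null_zeta; field.
  apply: (pitman_efficiencyP V n1 n0 _ _ _ _ muW' muW) => //; first exact: z_gt0 (lt0r_neq0 p_gt0).
  exact: cvg_unadjusted_var.
- set r := (X in is_pitman_efficiency _ _ _ _ _ _ _ X).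
  have -> : r = (null_zeta p 1 / 4) / (null_zeta p p / 4) *
      ((- (2^-1 * (p * cos phi + 2 * p ^+ 2 * sin phi))) /
       (- (2^-1 * (cos phi + 2 * p ^+ 2 * sin phi)))) ^+ 2.
    (* The two limiting variances share a factor p, which cancels in their ratio. *)
    have -> : null_zeta p p = p * (p ^+ 2 - p ^+ 3 + p ^+ 2 / 3) by rewrite /null_zeta; ring.
    have -> : null_zeta p 1 = p * (1 - p + p ^+ 2 / 3) by rewrite /null_zeta; ring.
    rewrite /r invrN mulrNN; field.
    by rewrite (gt_eqF l_gt0) (gt_eqF p_gt0) andbT (_ : _ + _ = 3 * (p ^+ 2 - p ^+ 3 + p ^+ 2 / 3)) ?mulf_neq0 //; field.
  apply: (pitman_efficiencyP V n1 n0 _ _ _ _ muW' muW) => //.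
    exact: z_gt0 (lt0r_neq0 p_gt0).
  exact: z_gt0 (oner_neq0 R).
Qed.
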